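(* Let $H\in(1/4,1)$, $T>0$, let $X$ be a 3-dimensional fractional Brownian motion with Hurst index $H$, and set $\alpha_H=\frac1{2H}+\frac12$. Let $\rho$ be a compactly supported signed measure on $\mathbb{R}^3$ with finite mass, with Fourier transform $\widehat\rho$. If $$\operatorname*{ess\,sup}_{q\in\mathbb{R}^3}\ |\widehat\rho(q)|\,|q|^{-1}(1+|q|^2)^{\alpha/2}<\infty\qquad\text{for some }\alpha>\alpha_H,$$ then the kinetic energy $\mathcal E=\int_{\mathbb{R}^3}|u(x)|^2dx$ of the vortex filament $\xi$ built upon $X$ and $\rho$ (see context) is a.s. finite and belongs to $L^1(\Omega)$.
   Context: A real fractional Brownian motion with Hurst index $H\in(0,1)$ is a mean-zero continuous Gaussian process $(B_t)_{t\ge0}$ with $\mathrm{Cov}(B_s,B_t)=\frac12(|s|^{2H}+|t|^{2H}-|s-t|^{2H})$; a 3-dimensional one has independent such components. Vortex core. Formally $\xi_0(x)=\int_0^T\delta(x-X_t)\,d^\circ X_t$. Rigorously, $\xi_0$ is the pathwise redefinition of the symmetric integral: a random element of $H_2^{-\alpha}(\mathbb{R}^3)$ (for every $\alpha>\alpha_H$), belonging to $L^2(\Omega;H_2^{-\alpha}(\mathbb{R}^3))$, such that for every smooth compactly supported vector field $\varphi$ on $\mathbb{R}^3$, a.s. $\xi_0(\varphi)=\lim_{\varepsilon\to0}\int_0^T\langle\varphi(X_t),\frac{X_{t+\varepsilon}-X_{t-\varepsilon}}{2\varepsilon}\rangle dt$ (limit in probability, which exists; $X_{t-\varepsilon}=0$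 for $t<\varepsilon$). The existence of $\xi_0$ with these properties for $H>1/4$ may be taken as known. Here $H_2^{s}(\mathbb{R}^3)$ is the space of tempered distributional vector fields $\varphi$ with $(1-\Delta)^{s/2}\varphi\in L^2$. Filament and velocity. The vorticity is $\xi(x)=\int_{\mathbb{R}^3}\xi_0(x-y)\rho(dy)$. The velocity is given by the Biot–Savart relation $u(x)=\int_{\mathbb{R}^3}\mathcal K(x-y)\wedge\xi(y)\,dy=\int_{\mathbb{R}^3}(\mathcal K*\rho)(x-y)\wedge\xi_0(y)\,dy$, with $\wedge$ the vector product, $\mathcal K(x)=\frac{1}{4\pi}\frac{x}{|x|^3}$ and $(\mathcal K*\rho)(x)=\int\mathcal K(x-z)\rho(dz)$. Rigorously $u=\Phi\xi_0$, where $\Phi$ is the Fourier multiplier operator with $\mathcal F(\Phi\xi_0)(q)=\widehat\rho(q)\frac{iq}{|q|^2}\wedge\mathcal F\xi_0(q)$ (up to normalization constants and sign conventions of the Fourier transform, which are irrelevant). $\mathcal E=+\infty$ by convention if $u\notin L^2(\mathbb{R}^3)$. *)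

(* Defs.v *)
From HB Require Import structures.
From mathcomp Require Import all_boot all_order all_algebra.
From mathcomp Require Import complex.
From mathcomp Require Import all_classical all_reals all_analysis ess_sup_inf.

Set Implicit Arguments.
Unset Strict Implicit.
Unset Printing Implicit Defensive.

Import Order.TTheory GRing.Theory Num.Theory.
Import numFieldNormedType.Exports.

Local Open Scope classical_set_scope.
Local Open Scope ring_scope.
Local Open Scope complex_scope.

(* R^3 is the iterated product, which carries both the normed-module structure
   and the product (= Borel) sigma-algebra; its canonical norm is the sup norm,
   so the Euclidean one is [enorm]. The library states Lebesgue measure on the
   alias [measurableTypeR R] of R (same Borel sets), hence [mR3]. *)
Notation R3 R := (R * R * R)%type.
Notation mR3 R := (measurableTypeR R * measurableTypeR R * measurableTypeR R)%type.

Section space.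
Context {R : realType}.

Definition coord3 (x : R3 R) (i : 'I_3) : R := nth 0 [:: x.1.1; x.1.2; x.2] i.

Definition vec3 (v : 'I_3 -> R) : R3 R := (v 0, v 1, v 2%:R).

Definition basis3 (i : 'I_3) : R3 R := vec3 (fun j => (i == j)%:R).

Definition dot (x y : R3 R) : R := \sum_(i < 3) coord3 x i * coord3 y i.

Definition enorm (x : R3 R) : R := Num.sqrt (dot x x).

Definition lebesgue3 : {measure set (mR3 R) -> \bar R} :=
  (@lebesgue_measure R \x @lebesgue_measure R \x @lebesgue_measure R)%E.

End space.

(* Indices in 'I_3 are added modulo 3. *)
Definition cross (S : pzRingType) (a b : 'I_3 -> S) : 'I_3 -> S :=
  fun i => a (i + 1) * b (i + 2%:R) - a (i + 2%:R) * b (i + 1).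

Section test_functions.
Context {R : realType}.
Implicit Types (f : R3 R -> R) (l : seq 'I_3).

Definition pderiv l f : R3 R -> R :=
  foldr (fun i g => fun x => 'D_(basis3 i) g x) f l.

Definition smooth f := forall l x, differentiable (pderiv l f) x.

Definition compactly_supported f :=
  exists2 K : set (R3 R), compact K & forall x, ~ K x -> f x = 0.

Definition schwartz f :=
  smooth f /\
  forall l k, exists C : R, forall x, (1 + enorm x) ^+ k * `|pderiv l f x| <= C.

End test_functions.

Section distributions.
Context {R : realType}.
Local Notation C := R[i].

Definition cintegral d (S : measurableType d) (mu : {measure set S -> \bar R})
    (f : S -> C) : C :=
  (\int[mu]_x complex.Re (f x))%R +i* (\int[mu]_x complex.Im (f x))%R.

Definition cintegrable d (S : measurableType d) (mu : {measure set S -> \bar R})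
    (f : S -> C) : Prop :=
  mu.-integrable setT (EFin \o (fun x => complex.Re (f x))) /\
  mu.-integrable setT (EFin \o (fun x => complex.Im (f x))).

Definition expi (t : R) : C := cos t +i* sin t.

(* Convention: (F phi)(q) = \int e^{i q.x} phi(x) dx.  Then convolution becomes
   multiplication and F(x / (4 pi |x|^3))(q) = i q / |q|^2, without any
   further constant. *)
Definition fourier (phi : R3 R -> R) : R3 R -> C :=
  fun q => cintegral lebesgue3 (fun x => expi (dot q x) * (phi x)%:C).

(* A (real) distribution is given by its values on Schwartz functions; its
   values on other functions carry no meaning. *)
Definition distribution3 := (R3 R -> R) -> R.

(* Linearity, and continuity for the Schwartz seminorms. *)
Definition tempered (U : distribution3) :=
  (forall (a : R) f g, schwartz f -> schwartz g ->
     U (fun x => a * f x + g x) = a * U f + U g) /\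
  exists (A : R) (N : nat), forall f, schwartz f -> forall M : R,
    (forall l x, (size l <= N)%N ->
       (1 + enorm x) ^+ N * `|pderiv l f x| <= M) ->
    `|U f| <= A * M.

Definition capply (U : distribution3) (f : R3 R -> C) : C :=
  U (fun x => complex.Re (f x)) +i* U (fun x => complex.Im (f x)).

Definition regular_dist (v : R3 R -> R) : distribution3 :=
  fun f => (\int[lebesgue3]_x (v x * f x))%R.

(* The Fourier transform of U, i.e. f |-> U (F f), is the function h. *)
Definition fourier_is (U : distribution3) (h : R3 R -> C) :=
  forall f, schwartz f ->
    cintegrable lebesgue3 (fun q => h q * (f q)%:C) /\
    capply U (fourier f) = cintegral lebesgue3 (fun q => h q * (f q)%:C).

End distributions.

Section vector_fields.
Context {R : realType}.
Local Notation C := R[i].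

Definition field3 := 'I_3 -> R3 R -> R.
Definition dfield3 := 'I_3 -> @distribution3 R.

Definition dfield_apply (U : dfield3) (phi : field3) : R :=
  \sum_(j < 3) U j (phi j).

Definition energy (v : field3) : \bar R :=
  (\int[lebesgue3]_x (\sum_(j < 3) (v j x) ^+ 2)%:E)%E.

Definition square_integrable (v : field3) :=
  (forall j, measurable_fun (setT : set (mR3 R)) (v j)) /\ (energy v < +oo)%E.

Definition japanese (s : R) (q : R3 R) : R := (1 + enorm q ^+ 2) `^ (s / 2).

(* g is a square-integrable field representing (1 - Delta)^(s/2) U, that is,
   F g = (1 + |q|^2)^(s/2) F U as tempered distributions. *)
Definition bessel_is (s : R) (U : dfield3) (g : field3) :=
  square_integrable g /\
  forall j f, schwartz f ->
    capply (regular_dist (g j)) (fourier f) =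
    capply (U j) (fourier (fun q => japanese s q * f q)).

Definition in_sobolev (s : R) (U : dfield3) :=
  (forall j, tempered (U j)) /\ exists g, bessel_is s U g.

(* Squared H_2^s norm. Two fields g representing the same distribution agree
   almost everywhere, so the set below has at most one element; it is empty,
   with infimum +oo, when there is no square-integrable representative. *)
Definition sobolev_norm2 (s : R) (U : dfield3) : \bar R :=
  ereal_inf [set energy g | g in bessel_is s U].

Definition sobolev_open (s : R) (O : set dfield3) :=
  forall U, in_sobolev s U -> O U -> exists2 r : R, 0 < r &
    forall V, in_sobolev s V ->
      (sobolev_norm2 s (fun j f => V j f - U j f)%R < r%:E)%E -> O V.

End vector_fields.

Section signed_measures.
Context d (S : measurableType d) {R : realType}.
Implicit Type nu : {charge set S -> \bar R}.

(* \int f d nu^+ - \int f d nu^-, for some Hahn decomposition of nu. *)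
Definition charge_integral nu (f : S -> R) : R :=
  let PN := cid (Hahn_decomposition nu) in
  let hd := projT2 (cid (projT2 PN)) in
  (\int[jordan_pos hd]_x f x)%R - (\int[jordan_neg hd]_x f x)%R.

End signed_measures.

Section velocity.
Context {R : realType}.
Local Notation C := R[i].
Implicit Types (rho : {charge set (mR3 R) -> \bar R}) (xi : @dfield3 R).

Definition charge_compactly_supported rho :=
  exists2 K : set (R3 R), compact K &
    forall A : set (mR3 R), measurable A -> A `&` K = set0 -> rho A = 0%E.

Definition charge_fourier rho (q : R3 R) : C :=
  charge_integral rho (fun x => cos (dot q x)) +i*
  charge_integral rho (fun x => sin (dot q x)).

(* hat rho (q) * (i q / |q|^2) /\ h(q), with /\ the vector product *)
Definition biot_savart_symbol rho (h : 'I_3 -> R3 R -> C) :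
    'I_3 -> R3 R -> C :=
  fun j q => charge_fourier rho q *
    cross (fun k => 0 +i* (coord3 q k / enorm q ^+ 2)) (h ^~ q) j.

(* u is a square-integrable field representing Phi xi, where Phi is the Fourier
   multiplier with the above symbol; h is the Fourier transform of xi. *)
Definition velocity_is rho xi (u : @field3 R) :=
  square_integrable u /\
  exists h : 'I_3 -> R3 R -> C,
    (forall j, fourier_is (xi j) (h j)) /\
    (forall j, fourier_is (regular_dist (u j)) (biot_savart_symbol rho h j)).

(* \int |u|^2 for the velocity u, and +oo (infimum of the empty set) when u is
   not in L^2; two fields u as below agree almost everywhere. *)
Definition kinetic_energy rho xi : \bar R :=
  ereal_inf [set energy u | u in velocity_is rho xi].

End velocity.

Section fractional_brownian_motion.
Context d (Omega : measurableType d) {R : realType} (P : probability Omega R).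

(* [normal_prob m s] is only the normal law for s != 0; degenerate Gaussian
   laws are Dirac masses. *)
Definition gaussian_rv (Y : Omega -> R) :=
  (exists m, forall V : set R, measurable V -> P (Y @^-1` V) = \d_m V) \/
  (exists m s, 0 < s /\ forall V : set R, measurable V ->
     P (Y @^-1` V) = normal_prob m s V).

(* Processes are indexed by R, but only nonnegative times matter. *)
Definition gaussian_process (B : R -> {RV P >-> R}) :=
  forall n (t a : 'I_n -> R), (forall k, 0 <= t k) ->
    gaussian_rv (fun w => \sum_(k < n) a k * B (t k) w).

Definition is_fbm (H : R) (B : R -> {RV P >-> R}) :=
  [/\ gaussian_process B,
      forall t, 0 <= t -> ('E_P[B t] = 0)%E,
      forall s t, 0 <= s -> 0 <= t ->
        covariance P (B s) (B t) =
        (2^-1 * (`|s| `^ (2 * H) + `|t| `^ (2 * H) - `|s - t| `^ (2 * H)))%:E &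
      forall w, {within `[0, +oo[, continuous (fun t => B t w)}].

Definition process_sigma_algebra (B : R -> {RV P >-> R}) : set (set Omega) :=
  <<s [set A | exists t (V : set R),
         [/\ 0 <= t, measurable V & A = B t @^-1` V]] >>.

Definition is_fbm3 (H : R) (X : 'I_3 -> R -> {RV P >-> R}) :=
  (forall i, is_fbm H (X i)) /\
  forall E : 'I_3 -> set Omega,
    (forall i, process_sigma_algebra (X i) (E i)) ->
    P (\bigcap_(i in setT) E i) = (\prod_(i < 3) P (E i))%E.

(* The path extended by 0 to negative times. *)
Definition path_at (X : 'I_3 -> R -> {RV P >-> R}) (i : 'I_3) (t : R)
    (w : Omega) : R :=
  if 0 <= t then X i t w else 0.

Definition symmetric_integral (X : 'I_3 -> R -> {RV P >-> R}) (T : R)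
    (phi : @field3 R) (eps : R) (w : Omega) : R :=
  (\int[lebesgue_measure]_(t in `[0, T])
     (\sum_(i < 3) phi i (vec3 (fun j => path_at X j t w)) *
        ((path_at X i (t + eps) w - path_at X i (t - eps) w) / (2 * eps))))%R.

Definition alphaH (H : R) : R := 1 / (2 * H) + 1 / 2.

(* Random elements of H_2^s are measurable for its Borel sigma-algebra. *)
Definition random_sobolev (s : R) (xi : Omega -> @dfield3 R) :=
  (forall w, in_sobolev s (xi w)) /\
  forall O, sobolev_open s O -> measurable (xi @^-1` O).

Definition is_vortex_core (H : R) (X : 'I_3 -> R -> {RV P >-> R}) (T : R)
    (xi0 : Omega -> @dfield3 R) :=
  (forall alpha, alphaH H < alpha ->
     random_sobolev (- alpha) xi0 /\
     (\int[P]_w sobolev_norm2 (- alpha) (xi0 w) < +oo)%E) /\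
  (forall phi : @field3 R,
     (forall j, smooth (phi j) /\ compactly_supported (phi j)) ->
     forall delta : R, 0 < delta ->
       P [set w | delta <=
           `|symmetric_integral X T phi eps w - dfield_apply (xi0 w) phi|]
         @[eps --> 0^'+] --> 0%E).

End fractional_brownian_motion.

(* Main.v *)
Require Import Defs.
From HB Require Import structures.
From mathcomp Require Import all_boot all_order all_algebra.
From mathcomp Require Import complex ring lra.
From mathcomp Require Import all_classical all_reals all_analysis ess_sup_inf.
From mathcomp Require Import measurable_realfun.

Set Implicit Arguments.
Unset Strict Implicit.
Unset Printing Implicit Defensive.

Import Order.TTheory GRing.Theory Num.Theory.
Import numFieldNormedType.Exports.

Local Open Scope classical_set_scope.
Local Open Scope ring_scope.

(** Let g be a square-integrable field representing (1 - Delta)^(-alpha/2) of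
    the vortex core.  The Fourier transform of the core is then the function
    h = (1 + |q|^2)^(alpha/2) F g, and that of the velocity is
    hat rho(q) (i q / |q|^2) /\ h(q), whose modulus is at most
    |hat rho(q)| |q|^-1 (1 + |q|^2)^(alpha/2) |F g(q)| <= M |F g(q)| for almost
    every q, where M bounds the essential supremum in the hypothesis.  By
    Plancherel the velocity is square integrable and its energy is at most a
    constant times the squared Sobolev norm of the core, a random variable with
    finite expectation.  Three points carry the argument.

    Fourier transform on L^2.  The Fourier transform is reduced to the Hartley
    transform, the real integral operator with kernel
    cas(q.x) = cos(q.x) + sin(q.x): the real and imaginary parts of F f are the
    Hartley transforms of the even and odd parts of f ([Re_fourier],
    [Im_fourier]).  This kernel is bounded and symmetric, hence self-adjoint on
    integrable functions.  Inserting the damping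
    exp(-e (|q_1| + |q_2| + |q_3|)) turns the square of the transform into
    convolution with a product of Poisson kernels 2 e / (e^2 + x^2), which is
    nonnegative and has a total mass c independent of e
    ([Rintegral_cas3M_damping3], [integral_poisson3]).  Schur's test, followed
    by Fatou's lemma as e tends to 0, bounds the squared norm of the transform
    by c times that of the function; the transform therefore extends to
    square-integrable functions along truncations, and the limit e -> 0 also
    gives the inversion formula, the square of the transform being c times the
    identity.  This is done for an abstract kernel in
    [kernel_transform_square_integrable].  A square-integrable function thus
    has a Fourier transform ([fourier_of_square_integrable]), and a pair of an
    even and an odd one is the Fourier transform of a real function
    ([square_integrable_with_fourier]); together with the pointwise bound on
    the multiplier, this gives the velocity and its energy estimate in
    [velocity_exists].  Testing against (1 + |q|^2)^(s/2) f for a Schwartz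
    function f requires this product to be a Schwartz function
    ([schwartz_japanese]).

    Measurability of the kinetic energy in the random parameter.  The core is
    measurable for the Borel sets of the Sobolev space, so it suffices that
    the sublevel sets of the kinetic energy be open there.  A perturbation of
    small Sobolev norm has a velocity of small energy, and adding it to a
    velocity of the unperturbed field gives a velocity of the perturbed one
    ([kinetic_energy_sublevel_open]).  The kinetic energy being an infimum over
    all velocities, their uniqueness is not needed.

    Integrability then follows from [kinetic_energy_le].  The constant 12 M^2
    in the estimate is not sharp; the losses come from splitting functions
    into parts and from bounding the components of the vector product one by
    one. *)

(** * Square-integrable functions *)

Section integral_complements.
Context d (T : measurableType d) (R : realType).
Variable m : {measure set T -> \bar R}.
Implicit Types f g h : T -> R.

(** The squared L^2 norm, in the extended reals. *)
Definition sq_norm f : \bar R := (\int[m]_x (f x ^+ 2)%:E)%E.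

Lemma integrable_measurable f :
  m.-integrable setT (EFin \o f) -> measurable_fun setT f.
Proof. by move=> /measurable_int/measurable_EFinP. Qed.

Lemma abs_Rintegral_le f : measurable_fun setT f ->
  (`|\int[m]_x f x|%:E <= \int[m]_x `|f x|%:E)%E.
Proof.
move=> mf; have H := le_abse_integral m measurableT (proj2 (measurable_EFinP _ _) mf).
apply: le_trans H; rewrite /Rintegral.
by case: (integral _ _ _) => [r||] //=; rewrite normr0 leey.
Qed.

Lemma integrable_le f g : measurable_fun setT f ->
  (forall x, `|f x| <= g x) -> m.-integrable setT (EFin \o g) ->
  m.-integrable setT (EFin \o f).
Proof.
move=> mf fg; apply: le_integrable => //; first exact/measurable_EFinP.
by move=> x _ /=; rewrite lee_fin (le_trans (fg x))// ler_norm.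
Qed.

Lemma integrable_bounded f g (B : R) : measurable_fun setT f ->
  (forall x, `|f x| <= B) -> m.-integrable setT (EFin \o g) ->
  m.-integrable setT (EFin \o (fun x => f x * g x)).
Proof.
move=> mf fB ig; have mg := integrable_measurable ig.
apply: (@integrable_le _ (fun x => B * `|g x|)).
- exact: measurable_funM.
- by move=> x; rewrite normrM ler_wpM2r.
- have /(integrableZl measurableT B) := integrable_norm ig.
  by apply: eq_integrable.
Qed.

Lemma sq_norm_integrable f : measurable_fun setT f -> (sq_norm f < +oo)%E ->
  m.-integrable setT (EFin \o (fun x => f x ^+ 2)).
Proof.
move=> mf foo; apply/integrableP; split.
  by apply/measurable_EFinP; exact: measurable_funX.
rewrite (le_lt_trans _ foo)// le_eqVlt; apply/orP; left; apply/eqP.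
by apply: eq_integral => x _ /=; rewrite ger0_norm// sqr_ge0.
Qed.

(** The product of two square-integrable functions is integrable. *)
Lemma integrable_sq_prod f g : measurable_fun setT f -> measurable_fun setT g ->
  (sq_norm f < +oo)%E -> (sq_norm g < +oo)%E ->
  m.-integrable setT (EFin \o (fun x => f x * g x)).
Proof.
move=> mf mg foo goo.
apply: (@integrable_le _ (fun x => f x ^+ 2 + g x ^+ 2)).
- exact: measurable_funM.
- move=> x; rewrite normrM.
  have := sqr_ge0 (`|f x| - `|g x|); rewrite -(real_normK (num_real (f x))).
  rewrite -(real_normK (num_real (g x))).
  have := normr_ge0 (f x); have := normr_ge0 (g x); nra.
- have := integrableD measurableT (sq_norm_integrable mf foo)
    (sq_norm_integrable mg goo).
  exact: eq_integrable.
Qed.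

Lemma measurable_sqr f : measurable_fun setT f ->
  measurable_fun setT (fun x => (f x ^+ 2)%:E).
Proof. by move=> mf; apply/measurable_EFinP; exact: measurable_funX. Qed.

Lemma sqr_EFin_ge0 f x : setT x -> (0 <= (f x ^+ 2)%:E)%E.
Proof. by move=> _; rewrite lee_fin sqr_ge0. Qed.

Hint Resolve sqr_EFin_ge0 measurable_sqr : core.

Lemma le_sq_norm f g : measurable_fun setT f -> measurable_fun setT g ->
  (forall x, `|f x| <= `|g x|) -> (sq_norm f <= sq_norm g)%E.
Proof.
move=> mf mg fg; apply: ge0_le_integral => //; [by auto|by auto|by auto|].
move=> x _; rewrite lee_fin -[leLHS](real_normK (num_real _)).
by rewrite -[leRHS](real_normK (num_real _)) lerXn2r ?nnegrE.
Qed.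

Lemma sq_normZ f (a : R) : measurable_fun setT f ->
  sq_norm (fun x => a * f x) = ((a ^+ 2)%:E * sq_norm f)%E.
Proof.
move=> mf; have mf2 := measurable_sqr mf; have f2 := sqr_EFin_ge0 f.
rewrite /sq_norm -ge0_integralZl ?lee_fin ?sqr_ge0//.
by apply: eq_integral => x _; rewrite exprMn EFinM.
Qed.

(** The triangle inequality for the squared norm, weighted by a free parameter
    e: a small e keeps the coefficient of the first term close to 1. *)
Lemma sq_normD f g (e : R) : 0 < e ->
  measurable_fun setT f -> measurable_fun setT g ->
  (sq_norm (fun x => f x + g x)%R <=
    (1 + e)%:E * sq_norm f + (1 + e^-1)%:E * sq_norm g)%E.
Proof.
move=> e0 mf mg.
have e1 : 0 <= 1 + e by rewrite addr_ge0 ?ltW.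
have e2 : 0 <= 1 + e^-1 by rewrite addr_ge0 ?invr_ge0 ?ltW.
have mf2 := measurable_sqr mf; have f2 := sqr_EFin_ge0 f.
have mg2 := measurable_sqr mg; have g2 := sqr_EFin_ge0 g.
rewrite /sq_norm -!ge0_integralZl ?lee_fin//.
rewrite -ge0_integralD//; first last.
- exact: emeasurable_funM.
- by move=> x _; rewrite mule_ge0 ?lee_fin// sqr_ge0.
- exact: emeasurable_funM.
- by move=> x _; rewrite mule_ge0 ?lee_fin// sqr_ge0.
apply: ge0_le_integral => //.
- exact/sqr_EFin_ge0.
- exact/measurable_sqr/measurable_funD.
- by apply: emeasurable_funD; exact: emeasurable_funM.
- move=> x _; rewrite -!EFinM -EFinD lee_fin -subr_ge0.
  have -> : (1 + e) * f x ^+ 2 + (1 + e^-1) * g x ^+ 2 - (f x + g x) ^+ 2 =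
            e * (f x - e^-1 * g x) ^+ 2 by field; rewrite gt_eqF.
  by rewrite mulr_ge0 ?sqr_ge0 ?ltW.
Qed.

Lemma Rdominated_cvg (u : nat -> T -> R) f g :
  (forall n, measurable_fun setT (u n)) -> measurable_fun setT f ->
  {ae m, forall x, u n x @[n --> \oo] --> f x} ->
  m.-integrable setT (EFin \o g) ->
  {ae m, forall x, forall n, `|u n x| <= g x} ->
  m.-integrable setT (EFin \o f) /\
  \int[m]_x u n x @[n --> \oo] --> \int[m]_x f x.
Proof.
move=> mu mf uf ig ug.
have [||||i1 _ c1] := @dominated_convergence _ _ _ m setT measurableT
  (fun n => EFin \o u n) (EFin \o f) (EFin \o g) _ _ _ ig.
- by move=> n; exact/measurable_EFinP.
- exact/measurable_EFinP.
- apply: filterS uf => x cx _; apply: cvg_EFin => //; exact: nearW.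
- by apply: filterS ug => x cx n _ /=; rewrite lee_fin.
split=> //.
by apply: fine_cvg; rewrite fineK ?integrable_fin_num.
Qed.

End integral_complements.

Section square_integrable_limits.
Context d (T : measurableType d) (R : realType).
Variable m : {measure set T -> \bar R}.
Implicit Types f g v : T -> R.

Lemma limn_einf_le (u : (\bar R)^nat) (M : \bar R) :
  (forall n, u n <= M)%E -> (limn_einf u <= M)%E.
Proof.
move=> uM; rewrite limn_einf_lim; apply: lime_le; first exact: is_cvg_einfs.
apply: nearW => n; apply: le_trans (uM n).
by apply: ereal_inf_lbound; exists n => //=.
Qed.

(** Fatou's lemma for real functions converging almost everywhere. *)
Lemma fatou_bound (u : nat -> T -> R) f (M : \bar R) :
  (forall n, measurable_fun setT (u n)) -> (forall n x, 0 <= u n x) ->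
  measurable_fun setT f -> (forall x, 0 <= f x) ->
  {ae m, forall x, u n x @[n --> \oo] --> f x} ->
  (forall n, (\int[m]_x (u n x)%:E <= M)%E) ->
  (\int[m]_x (f x)%:E <= M)%E.
Proof.
move=> mu u0 mf f0 uf uM.
have mu' n : measurable_fun setT (EFin \o u n) by exact/measurable_EFinP.
apply: (@le_trans _ _ (\int[m]_x (limn_einf (fun n => (u n x)%:E)))%E).
  apply: ae_ge0_le_integral => //.
  - by move=> x _; rewrite lee_fin.
  - exact/measurable_EFinP.
  - move=> x _; rewrite limn_einf_lim; apply: lime_ge; first exact: is_cvg_einfs.
    by apply: nearW => n; apply: le_ereal_inf_tmp => _ [p /= _ <-]; rewrite lee_fin.
  - rewrite (_ : (fun x => _) =
        (fun x => - limn_esup (fun n => - (u n x)%:E))%E); last first.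
      by apply/funext => x; rewrite -[LHS]oppeK -limn_esupN.
    apply: measurableT_comp => //; apply: measurable_fun_limn_esup => n.
    by apply/measurable_EFinP; exact: measurableT_comp.
  - apply: filterS uf => x ux _.
    have -> // : limn_einf (fun n => (u n x)%:E) = (f x)%:E.
    apply: (fun h => (cvg_limn_einf_sup h).1).
    by apply: cvg_EFin => //; exact: nearW.
apply: le_trans (fatou m measurableT mu' _) _; first by move=> n x _; rewrite lee_fin.
exact: limn_einf_le.
Qed.

(** A square-integrable v is approximated by its truncations
    v 1_{|v| >= 1/(n+1)}, which are integrable; along a subsequence the squared
    error is at most 16^-n. *)
Lemma square_integrable_truncation v : measurable_fun setT v ->
  (sq_norm m v < +oo)%E ->
  exists phi : nat -> T -> R, [/\ forall n, measurable_fun setT (phi n),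
    forall n, m.-integrable setT (EFin \o phi n),
    forall n x, `|phi n x| <= `|v x|,
    forall n, (sq_norm m (fun x => v x - phi n x)%R <= (16%:R^-1 ^+ n)%:E)%E &
    forall x, phi n x @[n --> \oo] --> v x].
Proof.
move=> mv v2.
pose tr n x := if n.+1%:R^-1 <= `|v x| then v x else 0.
have mtr n : measurable_fun setT (tr n).
  apply: measurable_fun_ifT => //; apply: measurable_fun_ler => //.
  exact: measurableT_comp.
have trv n x : `|tr n x| <= `|v x| by rewrite /tr; case: ifP => //; rewrite normr0.
have itr n : m.-integrable setT (EFin \o tr n).
  (* where |v| >= 1/(n+1), |v| is at most (n+1) v^2 *)
  apply: (@integrable_le _ _ _ _ _ (fun x => n.+1%:R * v x ^+ 2)) => //.
    move=> x; rewrite /tr; case: ifPn => [nv|_]; last first.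
      by rewrite normr0 mulr_ge0// sqr_ge0.
    rewrite -(real_normK (num_real (v x))) expr2 mulrA ler_peMl//.
    by rewrite -ler_pdivrMl// mulr1.
  have := integrableZl measurableT n.+1%:R (sq_norm_integrable mv v2).
  by apply: eq_integrable.
have trcv x : {near \oo, forall n, tr n x = v x}.
  have [v0|v0] := eqVneq (v x) 0.
    by apply: nearW => n; rewrite /tr v0 if_same.
  near=> n; rewrite /tr ifT//.
  rewrite invf_ple ?posrE ?normr_gt0// ltW//.
  rewrite (le_lt_trans (ltW (archi_boundP _)))// ?invr_ge0//.
  by rewrite ltr_nat ltnS; near: n; exact: nbhs_infty_ge.
have c0 : \int[m]_x (v x - tr n x) ^+ 2 @[n --> \oo] --> (0 : R).
  have [|||||_] := @Rdominated_cvg _ _ _ m (fun n x => (v x - tr n x) ^+ 2)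
    (cst 0) (fun x => v x ^+ 2).
  - by move=> n; apply: measurable_funX; exact: measurable_funB.
  - exact: measurable_cst.
  - apply: aeW => x; apply: cvg_near_cst; near=> n.
    by rewrite (near (trcv x) n)// subrr expr0n.
  - exact: sq_norm_integrable.
  - apply: aeW => x n; rewrite /tr; case: ifP => _.
      by rewrite subrr expr0n normr0 sqr_ge0.
    by rewrite subr0 ger0_norm// sqr_ge0.
  by rewrite [X in _ --> X]Rintegral_cst// mul0r.
have sqE n : sq_norm m (fun x => v x - tr n x) =
    (\int[m]_x (v x - tr n x) ^+ 2)%:E.
  rewrite fineK//; apply: integrable_fin_num => //.
  apply: sq_norm_integrable; first exact: measurable_funB.
  apply: le_lt_trans v2; apply: le_sq_norm => //; first exact: measurable_funB.
  by move=> x; rewrite /tr; case: ifP => _; rewrite ?subrr ?normr0// subr0.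
have sel k : exists n, (k <= n)%N /\
    (sq_norm m (fun x => v x - tr n x)%R <= (16%:R^-1 ^+ k)%:E)%E.
  have e0 : 0 < 16%:R^-1 ^+ k :> R by rewrite exprn_gt0// invr_gt0.
  have /cvgrPdist_lt/(_ _ e0)[N _ NP] := c0.
  exists (maxn k N); split; first exact: leq_maxl.
  rewrite sqE lee_fin; have := NP _ (leq_maxr k N).
  by rewrite sub0r normrN => /ltW; apply: le_trans; exact: ler_norm.
have [s sP] := choice sel.
exists (fun k => tr (s k)); split => //.
- by move=> k; have [] := sP k.
- move=> x; apply: cvg_near_cst.
  have [N _ NP] := trcv x; exists N => // k /= Nk.
  by apply: NP => /=; rewrite (leq_trans Nk)//; have [] := sP k.
Unshelve. all: by end_near. Qed.

(** A sequence whose increments have squared norms decreasing like 16^-n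
    converges almost everywhere and is dominated by a square-integrable
    function.  The squared increments, multiplied by 4^n, form a series S with
    finite integral; where S is finite the n-th increment is at most
    2^-n sqrt(S), so that |u_0| + 2 sqrt(S) dominates the sequence. *)
Lemma square_integrable_fast_cauchy (u : nat -> T -> R) (C : R) :
  (forall n, measurable_fun setT (u n)) -> (sq_norm m (u 0%N) < +oo)%E ->
  0 <= C ->
  (forall n, (sq_norm m (fun x => u n.+1 x - u n x)%R <= (C * 16%:R^-1 ^+ n)%:E)%E) ->
  exists W E : T -> R, [/\ measurable_fun setT W, measurable_fun setT E,
    (sq_norm m E < +oo)%E,
    {ae m, forall x, u n x @[n --> \oo] --> W x} &
    {ae m, forall x, forall n, `|u n x| <= E x}].
Proof.
move=> mu u02 C0 uC.
pose D n x := u n.+1 x - u n x.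
have mD n : measurable_fun setT (D n) by exact: measurable_funB.
pose t n x : \bar R := (4%:R ^+ n * D n x ^+ 2)%:E.
have t0 n x : (0 <= t n x)%E by rewrite lee_fin mulr_ge0 ?sqr_ge0// exprn_ge0.
have mt n : measurable_fun setT (t n).
  by apply/measurable_EFinP; apply: measurable_funM => //; exact: measurable_funX.
pose S x := (\sum_(n <oo) t n x)%E.
have S0 x : (0 <= S x)%E by apply: nneseries_ge0.
have mS : measurable_fun setT S by apply: ge0_emeasurable_sum.
have geo n : \sum_(0 <= k < n) 4%:R^-1 ^+ k <= 2 - 2 * 4%:R^-1 ^+ n :> R.
  elim: n => [|n IH]; first by rewrite big_geq// expr0; lra.
  rewrite big_nat_recr//= exprS.
  have : 0 <= 4%:R^-1 ^+ n :> R by rewrite exprn_ge0// invr_ge0.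
  by move: IH; lra.
have IS : (\int[m]_x S x <= (C * 2)%:E)%E.
  rewrite integral_nneseries//; apply: lime_le.
    by apply: is_cvg_nneseries => n _ _; exact: integral_ge0.
  apply: nearW => n.
  apply: (@le_trans _ _ (\sum_(0 <= k < n) (C * 4%:R^-1 ^+ k)%:E)%E).
    apply: lee_sum => k _.
    rewrite /t (eq_integral (fun x => (4%:R ^+ k)%:E * (D k x ^+ 2)%:E)%E)//.
    rewrite ge0_integralZl ?lee_fin ?exprn_ge0//; first last.
    - exact: sqr_EFin_ge0.
    - exact: measurable_sqr.
    apply: (le_trans (lee_wpmul2l _ (uC k))); first by rewrite lee_fin exprn_ge0.
    rewrite -EFinM lee_fin mulrCA -exprMn ler_wpM2l// lerXn2r ?nnegrE//; lra.
  rewrite sumEFin lee_fin -mulr_sumr ler_wpM2l//.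
  by apply: le_trans (geo n) _; rewrite gerBl mulr_ge0// exprn_ge0// invr_ge0.
have iS : m.-integrable setT S.
  apply/integrableP; split => //.
  rewrite (eq_integral S); last by move=> x _; rewrite gee0_abs.
  by apply: le_lt_trans IS _; rewrite ltry.
have aeS : {ae m, forall x, S x \is a fin_num}.
  by have := integrable_ae measurableT iS; apply: filterS => x; exact.
pose s x := fine (S x).
have s0 x : 0 <= s x by exact: fine_ge0.
have ms : measurable_fun setT s by exact: measurableT_comp.
have Ds x n : S x \is a fin_num -> `|D n x| <= 2^-1 ^+ n * Num.sqrt (s x).
  move=> Sx.
  have : (t n x <= S x)%E.
    apply: le_trans (nneseries_lim_ge n.+1 _); last by move=> *.
    by rewrite big_nat_recr//= leeDr// sume_ge0.
  rewrite -(fineK Sx) lee_fin -/(s x) => tn.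
  have p2 : 0 <= 2^-1 ^+ n :> R by rewrite exprn_ge0// invr_ge0.
  rewrite -(@ler_pXn2r _ 2) ?nnegrE// ?mulr_ge0 ?sqrtr_ge0//.
  rewrite exprMn sqr_sqrtr// real_normK ?num_real// -exprM mulnC exprM exprVn.
  by rewrite -ler_pdivrMl ?exprn_gt0 ?invr_gt0 ?exprn_gt0// exprVn invrK -natrX.
have geo2 n : \sum_(0 <= k < n) 2^-1 ^+ k <= 2 :> R.
  suff : \sum_(0 <= k < n) 2^-1 ^+ k = 2 - 2 * 2^-1 ^+ n :> R.
    by move=> ->; rewrite gerBl mulr_ge0// exprn_ge0// invr_ge0.
  elim: n => [|n IH]; first by rewrite big_geq// expr0; lra.
  by rewrite big_nat_recr//= exprS IH; field.
exists (fun x => fine (limn_esup (fun n => (u n x)%:E))),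
       (fun x => `|u 0%N x| + 2 * Num.sqrt (s x)).
have ms2 : measurable_fun setT (fun x => Num.sqrt (s x)).
  apply: (measurableT_comp _ ms); apply: continuous_measurable_fun.
  exact: sqrt_continuous.
have mE : measurable_fun setT (fun x => `|u 0%N x| + 2 * Num.sqrt (s x)).
  apply: measurable_funD; first exact: measurableT_comp.
  exact: measurable_funM.
split => //.
- apply: measurableT_comp => //; apply: measurable_fun_limn_esup => n.
  exact/measurable_EFinP.
- apply: le_lt_trans (sq_normD m (@ltr01 R) _ _) _.
  + exact: measurableT_comp.
  + exact: measurable_funM.
  apply: lte_add_pinfty; rewrite lte_mul_pinfty//.
  + rewrite (_ : sq_norm _ _ = sq_norm m (u 0%N))//.
    by apply: eq_integral => x _; rewrite real_normK ?num_real.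
  + rewrite sq_normZ//.
    rewrite lte_mul_pinfty//.
    apply: le_lt_trans (integrable_lty measurableT iS).
    apply: ge0_le_integral => //.
    * exact: measurable_sqr.
    * by move=> x _; rewrite sqr_sqrtr//; rewrite /s; case: (S x) (S0 x).
- apply: filterS aeS => x Sx.
  have cu : cvgn (u ^~ x).
    rewrite (_ : u ^~ x = (fun n => u 0%N x + series (telescope (u ^~ x)) n)).
      apply: is_cvgD; first exact: is_cvg_cst.
      apply: normed_cvg.
      apply: (@series_le_cvg _ _ (geometric (Num.sqrt (s x)) 2^-1)) => //.
      + by move=> n /=.
      + by move=> n /=; rewrite mulr_ge0 ?sqrtr_ge0// exprn_ge0// invr_ge0.
      + by move=> n /=; rewrite mulrC; exact: Ds.
      + by apply: is_cvg_geometric_series; rewrite ger0_norm; lra.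
    by apply/funext => n; exact: (eq_sum_telescope (u ^~ x)).
  have cE : (u n x)%:E @[n --> \oo] --> (limn (u ^~ x))%:E.
    by apply: cvg_EFin => //; exact: nearW.
  by rewrite (cvg_limn_einf_sup cE).2 /=.
- apply: filterS aeS => x Sx n.
  rewrite [u n x](eq_sum_telescope (u ^~ x)) (le_trans (ler_normD _ _))// lerD2l.
  rewrite /series /= (le_trans (ler_norm_sum _ _ _))//.
  apply: (@le_trans _ _ (\sum_(0 <= k < n) 2^-1 ^+ k * Num.sqrt (s x))).
    by apply: ler_sum => k _; exact: Ds.
  by rewrite -mulr_suml ler_wpM2r ?sqrtr_ge0.
Qed.

End square_integrable_limits.

(** * Integrals over products *)

Section product_integrals.
Context d1 d2 (T1 : measurableType d1) (T2 : measurableType d2) (R : realType).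
Variables (m1 : {sigma_finite_measure set T1 -> \bar R})
          (m2 : {sigma_finite_measure set T2 -> \bar R}).

Lemma measurable_parametric_Rintegral (F : T1 * T2 -> R) :
  measurable_fun setT F ->
  measurable_fun setT (fun x => \int[m2]_y F (x, y)).
Proof.
move=> mF; apply: measurableT_comp => //.
have mE : measurable_fun setT (EFin \o F) by exact/measurable_EFinP.
rewrite (_ : (fun x => _) = (fubini_F m2 (fun z => (EFin \o F)^\+ z) \-
   fubini_F m2 (fun z => (EFin \o F)^\- z))%E); last first.
  apply/funext => x; rewrite [LHS]integralE /fubini_F /=; congr (_ - _)%E;
    by apply: eq_integral => y _; rewrite (funeposE, funenegE) (funeposE, funenegE).
apply: emeasurable_funB; apply: measurable_fun_fubini_tonelli_F => //.
- exact: measurable_funepos.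
- exact: measurable_funeneg.
Qed.

(** The product of functions of separate variables is integrable. *)
Lemma integrable_tensor (a : T1 -> R) (b : T2 -> R) :
  m1.-integrable setT (EFin \o a) -> m2.-integrable setT (EFin \o b) ->
  (m1 \x m2)%E.-integrable setT (EFin \o (fun z => a z.1 * b z.2)).
Proof.
move=> ia ib.
have ma := integrable_measurable ia; have mb := integrable_measurable ib.
apply/integrable12ltyP.
  apply/measurable_EFinP; apply: measurable_funM.
  - exact: measurableT_comp.
  - exact: measurableT_comp.
have /integrable_norm nia := ia; have /integrable_norm nib := ib.
rewrite (eq_integral (fun x => `|a x|%:E * \int[m2]_y (`|b y|%:E))%E); last first.
  move=> x _ /=; rewrite -ge0_integralZl//.
  - by apply: eq_integral => y _; rewrite normrM.
  - by move/measurable_int : nib.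
rewrite ge0_integralZr//.
- rewrite lte_mul_pinfty//; last exact: integrable_lty nib.
  + exact: integral_ge0.
  + exact: integrable_fin_num nia.
- by move/measurable_int : nia.
- exact: integral_ge0.
Qed.

Lemma Rintegral_fubini (F : T1 * T2 -> R) :
  (m1 \x m2)%E.-integrable setT (EFin \o F) ->
  (forall x, m2.-integrable setT (EFin \o (fun y => F (x, y)))) ->
  (forall y, m1.-integrable setT (EFin \o (fun x => F (x, y)))) ->
  \int[m1]_x (\int[m2]_y F (x, y)) = \int[m2]_y (\int[m1]_x F (x, y)).
Proof.
move=> iF iF1 iF2; congr fine; have := Fubini iF.
rewrite [LHS](eq_integral (fun x => (\int[m2]_y F (x, y))%:E)%R); last first.
  by move=> x _; rewrite fineK//; exact: integrable_fin_num (iF1 x).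
rewrite [RHS](eq_integral (fun y => (\int[m1]_x F (x, y))%:E)%R)//.
by move=> y _; rewrite fineK//; exact: integrable_fin_num (iF2 y).
Qed.

End product_integrals.

(** * Transforms with a bounded symmetric kernel *)

Section bounded_kernel.
Context d (T : measurableType d) (R : realType).
Variables (m : {sigma_finite_measure set T -> \bar R}) (k : T * T -> R) (B : R).
Hypotheses (mk : measurable_fun setT k) (kB : forall z, `|k z| <= B)
  (kC : forall x y, k (x, y) = k (y, x)).
Implicit Types f g v w : T -> R.

(** The integral operator with kernel k. *)
Definition kernel_transform f x := \int[m]_y (k (x, y) * f y).
Notation Hk := kernel_transform.

Let mk1 x : measurable_fun setT (fun y => k (x, y)).
Proof. exact: measurableT_comp. Qed.

Lemma integrable_kernel f x : m.-integrable setT (EFin \o f) ->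
  m.-integrable setT (EFin \o (fun y => k (x, y) * f y)).
Proof. by move=> intf; exact: (@integrable_bounded _ _ _ _ _ _ B). Qed.

Lemma measurable_kernel_transform f :
  measurable_fun setT f -> measurable_fun setT (Hk f).
Proof.
move=> mf; apply: (@measurable_parametric_Rintegral _ _ _ _ _ m
  (fun z => k z * f z.2)).
by apply: measurable_funM => //; exact: measurableT_comp.
Qed.

Lemma kernel_transform_bounded f : m.-integrable setT (EFin \o f) ->
  exists C, forall x, `|Hk f x| <= C.
Proof.
move=> intf; exists (\int[m]_y (B * `|f y|)) => x.
apply: (le_trans (le_normr_Rintegral _ (integrable_kernel x intf))) => //.
apply: le_Rintegral => //.
- exact: (integrable_norm (integrable_kernel x intf)).
- apply: eq_integrable (integrableZl measurableT B (integrable_norm intf)) => //.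
- by move=> y _; rewrite normrM ler_wpM2r.
Qed.

Lemma kernel_transformB f g x : m.-integrable setT (EFin \o f) ->
  m.-integrable setT (EFin \o g) ->
  Hk (fun y => f y - g y) x = Hk f x - Hk g x.
Proof.
move=> intf intg; rewrite /Hk -RintegralB//; try exact: integrable_kernel.
by apply: eq_Rintegral => y _; rewrite mulrBr.
Qed.

(** Self-adjointness on integrable functions, by Fubini. *)
Lemma kernel_transform_dual f g : m.-integrable setT (EFin \o f) ->
  m.-integrable setT (EFin \o g) ->
  \int[m]_x (Hk f x * g x) = \int[m]_x (f x * Hk g x).
Proof.
move=> intf intg.
have iF : (m \x m)%E.-integrable setT (EFin \o (fun z => k z * (g z.1 * f z.2))).
  by apply: (@integrable_bounded _ _ _ _ _ _ B) => //; exact: integrable_tensor.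
have := Rintegral_fubini iF.
rewrite (_ : \int[m]_x _ = \int[m]_x (Hk f x * g x)); last first.
  apply: eq_Rintegral => x _; rewrite -RintegralZr//; last exact: integrable_kernel.
  by apply: eq_Rintegral => y _ /=; ring.
rewrite [X in _ -> _ -> _ = X](_ : _ = \int[m]_x (f x * Hk g x)); last first.
  apply: eq_Rintegral => x _; rewrite -RintegralZl//; last exact: integrable_kernel.
  by apply: eq_Rintegral => y _ /=; rewrite kC; ring.
apply=> x /=.
- apply: (@integrable_bounded _ _ _ _ _ _ B) => //.
  exact: (integrableZl measurableT (g x) intf).
- apply: (@integrable_bounded _ _ _ _ _ _ B) => //.
    exact: measurableT_comp.
  exact: (integrableZr measurableT (f x) intg).
Qed.

(** A summation method for the square of the transform: damping by K n between
    the two integrations turns it into the operator with the nonnegative kernel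
    G n, whose integral in one variable is the constant c. *)
Variables (K : nat -> T -> R) (G : nat -> T * T -> R) (c : R).
Hypotheses (iK : forall n, m.-integrable setT (EFin \o K n))
  (K0 : forall n x, 0 <= K n x) (K1 : forall n x, K n x <= 1)
  (Kcvg : forall x, K n x @[n --> \oo] --> (1 : R))
  (mG : forall n, measurable_fun setT (G n)) (G0 : forall n z, 0 <= G n z)
  (c0 : 0 <= c)
  (GE : forall n x y, \int[m]_q (k (x, q) * k (y, q) * K n q) = G n (x, y))
  (Gc : forall n x, (\int[m]_y (G n (x, y))%:E = c%:E)%E).

(** The operator with kernel G n, which is also the transform applied to K n
    times the transform of f, see [kernel_transform_regularized]. *)
Definition regularize n f x := \int[m]_y (G n (x, y) * f y).

Let GC n x y : G n (x, y) = G n (y, x).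
Proof. by rewrite -!GE; apply: eq_Rintegral => q _; rewrite (mulrC (k _)). Qed.

Lemma kernel_transform_regularized n w x : m.-integrable setT (EFin \o w) ->
  Hk (fun q => K n q * Hk w q) x = regularize n w x.
Proof.
move=> iw; rewrite /Hk.
rewrite (_ : \int[m]_y _ = \int[m]_q (Hk w q * (k (x, q) * K n q))); last first.
  by apply: eq_Rintegral => q _; rewrite /Hk; ring.
rewrite kernel_transform_dual//; last exact: integrable_kernel.
apply: eq_Rintegral => y _; rewrite mulrC; congr *%R.
by rewrite -GE; apply: eq_Rintegral => q _; ring.
Qed.

(** Schur's test: since |w(x) w(y)| <= (w(x)^2 + w(y)^2) / 2, the quadratic form
    is controlled by the integral of G n in each variable. *)
Lemma regularize_energy n w : measurable_fun setT w ->
  (`|\int[m]_x (w x * regularize n w x)|%:E <= c%:E * sq_norm m w)%E.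
Proof.
move=> mw.
have mr : measurable_fun setT (regularize n w).
  apply: (@measurable_parametric_Rintegral _ _ _ _ _ m (fun z => G n z * w z.2)).
  by apply: measurable_funM => //; exact: measurableT_comp.
apply: le_trans (abs_Rintegral_le _ _) _; first exact: measurable_funM.
have mG1 x : measurable_fun setT (fun y => G n (x, y)) by exact: measurableT_comp.
pose h x := 2^-1 * w x ^+ 2.
have h0 x : 0 <= h x by rewrite mulr_ge0 ?sqr_ge0// invr_ge0.
have mh : measurable_fun setT h by apply: measurable_funM => //; exact: measurable_funX.
have hE : (\int[m]_x (c * h x)%:E = (c * 2^-1)%:E * sq_norm m w)%E.
  rewrite /sq_norm -ge0_integralZl ?lee_fin ?mulr_ge0 ?invr_ge0//; first last.
  - exact: sqr_EFin_ge0.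
  - exact: measurable_sqr.
  by apply: eq_integral => x _; rewrite -EFinM mulrA.
have mGh1 : measurable_fun setT (fun z => (G n z * h z.1)%:E).
  by apply/measurable_EFinP; apply: measurable_funM => //; exact: measurableT_comp.
have mGh2 : measurable_fun setT (fun z => (G n z * h z.2)%:E).
  by apply/measurable_EFinP; apply: measurable_funM => //; exact: measurableT_comp.
have Gh1 z : (0 <= (G n z * h z.1)%:E)%E by rewrite lee_fin mulr_ge0.
have Gh2 z : (0 <= (G n z * h z.2)%:E)%E by rewrite lee_fin mulr_ge0.
have h1 : (\int[m]_x \int[m]_y (G n (x, y) * h x)%:E = \int[m]_x (c * h x)%:E)%E.
  apply: eq_integral => x _; rewrite EFinM -(Gc n x) -ge0_integralZr//.
  - exact/measurable_EFinP.
  - by move=> y _; rewrite lee_fin.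
  - by rewrite lee_fin.
have h2 : (\int[m]_x \int[m]_y (G n (x, y) * h y)%:E = \int[m]_x (c * h x)%:E)%E.
  rewrite (fubini_tonelli (fun z => (G n z * h z.2)%:E))// -h1.
  apply: eq_integral => x _; apply: eq_integral => y _ /=.
  by rewrite GC.
apply: (@le_trans _ _ (\int[m]_x \int[m]_y ((G n (x, y) * h x)%:E + (G n (x, y) * h y)%:E))%E).
  apply: ge0_le_integral => //.
  - by apply/measurable_EFinP; apply: measurableT_comp => //; exact: measurable_funM.
  - apply: (measurable_fun_fubini_tonelli_F
      (fun z => (G n z * h z.1)%:E + (G n z * h z.2)%:E)%E).
      exact: emeasurable_funD.
    by move=> z; rewrite adde_ge0.
  - move=> x _; rewrite normrM EFinM.
    have r1 : (`|regularize n w x|%:E <= \int[m]_y `|G n (x, y) * w y|%:E)%E.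
      by apply: abs_Rintegral_le; exact: measurable_funM.
    apply: (le_trans (lee_wpmul2l _ r1)); first by rewrite lee_fin.
    rewrite -ge0_integralZl//; first last.
      by apply/measurable_EFinP; apply: measurableT_comp => //; exact: measurable_funM.
    apply: ge0_le_integral => //.
    + apply: measurable_funeM.
      by apply/measurable_EFinP; apply: measurableT_comp => //; exact: measurable_funM.
    + apply: emeasurable_funD; apply/measurable_EFinP; exact: measurable_funM.
    + move=> y _; rewrite -EFinM -EFinD lee_fin -mulrDr normrM.
      rewrite (ger0_norm (G0 _ _)) mulrCA ler_wpM2l// /h -mulrDr.
      rewrite -(real_normK (num_real (w x))) -(real_normK (num_real (w y))).
      by have := sqr_ge0 (`|w x| - `|w y|); nra.
rewrite (eq_integral (fun x => \int[m]_y (G n (x, y) * h x)%:E + \int[m]_y (G n (x, y) * h y)%:E)%E); last first.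
  move=> x _; rewrite ge0_integralD//.
  - by apply/measurable_EFinP; exact: measurable_funM.
  - by apply/measurable_EFinP; exact: measurable_funM.
rewrite ge0_integralD//; first last.
- exact: (measurable_fun_fubini_tonelli_F (fun z => (G n z * h z.2)%:E)).
- by move=> x _; exact: integral_ge0.
- exact: (measurable_fun_fubini_tonelli_F (fun z => (G n z * h z.1)%:E)).
- by move=> x _; exact: integral_ge0.
rewrite h1 h2 hE -ge0_muleDl ?lee_fin ?mulr_ge0 ?invr_ge0//.
by rewrite -EFinD (_ : c * 2^-1 + c * 2^-1 = c)//; field.
Qed.

Lemma regularize_bounded n f M x : measurable_fun setT f ->
  (forall y, `|f y| <= M) -> `|regularize n f x| <= c * M.
Proof.
move=> mf fM; rewrite -lee_fin.
have mG1 : measurable_fun setT (fun y => G n (x, y)) by exact: measurableT_comp.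
apply: le_trans (abs_Rintegral_le _ _) _; first exact: measurable_funM.
rewrite EFinM -(Gc n x) -ge0_integralZr//.
- apply: ge0_le_integral => //.
  + apply/measurable_EFinP; apply: measurableT_comp => //.
    exact: measurable_funM.
  + by apply/measurable_EFinP; exact: measurable_funM.
  + by move=> y _; rewrite -EFinM lee_fin normrM ger0_norm// ler_wpM2l.
- exact/measurable_EFinP.
- by move=> y _; rewrite lee_fin.
- by rewrite lee_fin (le_trans _ (fM x)).
Qed.

Let integrable_damped n w : m.-integrable setT (EFin \o w) ->
  m.-integrable setT (EFin \o (fun q => K n q * Hk w q)).
Proof.
move=> iw; have [C HC] := kernel_transform_bounded iw.
have := @integrable_bounded _ _ _ m (Hk w) (K n) C.
move=> /(_ (measurable_kernel_transform (integrable_measurable iw)) HC (iK n)).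
by apply: eq_integrable => // x _ /=; rewrite mulrC.
Qed.

Lemma kernel_transform_dual_regularized n w f :
  m.-integrable setT (EFin \o w) -> m.-integrable setT (EFin \o f) ->
  \int[m]_q (K n q * (Hk w q * Hk f q)) = \int[m]_x (w x * regularize n f x).
Proof.
move=> iw jf; rewrite (_ : \int[m]_q _ = \int[m]_q (Hk w q * (K n q * Hk f q))).
  rewrite (kernel_transform_dual iw (integrable_damped n jf)).
  by apply: eq_Rintegral => x _; rewrite kernel_transform_regularized.
by apply: eq_Rintegral => x _; ring.
Qed.

(** The Plancherel inequality for integrable functions: the damped squared norm
    of the transform is the quadratic form of [regularize]. *)
Lemma sq_norm_kernel_transform w : m.-integrable setT (EFin \o w) ->
  (sq_norm m (Hk w) <= c%:E * sq_norm m w)%E.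
Proof.
move=> iw; have mw := integrable_measurable iw.
have mH := measurable_kernel_transform mw.
apply: (@fatou_bound _ _ _ m (fun n q => K n q * (Hk w q * Hk w q))) => //.
- move=> n; apply: measurable_funM; first exact: integrable_measurable (iK n).
  exact: measurable_funM.
- by move=> n x; rewrite mulr_ge0// -expr2 sqr_ge0.
- exact: measurable_funX.
- by move=> x; exact: sqr_ge0.
- apply: aeW => x; rewrite -[X in _ --> X]mul1r.
  by apply: cvgM => //; exact: cvg_cst.
- move=> n; apply: le_trans (regularize_energy n mw).
  rewrite -kernel_transform_dual_regularized// ger0_norm; last first.
    by apply: Rintegral_ge0 => x _; rewrite mulr_ge0// -expr2 sqr_ge0.
  rewrite /Rintegral fineK//; apply: integrable_fin_num => //.
  have [C HC] := kernel_transform_bounded iw.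
  have := @integrable_bounded _ _ _ m (Hk w) _ C mH HC (integrable_damped n iw).
  by apply: eq_integrable => // x _ /=; congr EFin; ring.
Qed.

(** The transform of a square-integrable function v, characterized by duality,
    with the inversion formula.  The functions f are those for which the
    summation method converges pointwise to c f. *)
Theorem kernel_transform_square_integrable v : measurable_fun setT v ->
  (sq_norm m v < +oo)%E ->
  exists W : T -> R, [/\ measurable_fun setT W, (sq_norm m W <= c%:E * sq_norm m v)%E &
    forall f (M : R), m.-integrable setT (EFin \o f) -> (forall x, `|f x| <= M) ->
      (forall x, regularize n f x @[n --> \oo] --> c * f x) ->
      [/\ m.-integrable setT (EFin \o (fun x => W x * f x)),
          m.-integrable setT (EFin \o (fun x => W x * Hk f x)),
          \int[m]_x (W x * f x) = \int[m]_x (v x * Hk f x) &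
          \int[m]_x (W x * Hk f x) = c * \int[m]_x (v x * f x)]].
Proof.
move=> mv v2.
have [phi [mphi iphi phiv phi2 phicvg]] := square_integrable_truncation mv v2.
have mH j := measurable_kernel_transform (mphi j).
have phiv2 j : (sq_norm m (phi j) <= sq_norm m v)%E by exact: le_sq_norm.
have Hphi2 j : (sq_norm m (Hk (phi j)) <= c%:E * sq_norm m v)%E.
  apply: le_trans (sq_norm_kernel_transform (iphi j)) _.
  by rewrite lee_wpmul2l// lee_fin.
have cvfin : (c%:E * sq_norm m v < +oo)%E by rewrite lte_mul_pinfty// lee_fin.
have C0 : 0 <= c * 4 by rewrite mulr_ge0.
have [j|W [E [mW mE E2 Wcvg EH]]] :=
    square_integrable_fast_cauchy mH (le_lt_trans (Hphi2 0%N) cvfin) C0.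
  rewrite (_ : (fun x => _) = Hk (fun y => phi j.+1 y - phi j y)); last first.
    by apply/funext => x; rewrite kernel_transformB.
  have id : m.-integrable setT (EFin \o (fun y => phi j.+1 y - phi j y)).
    by have := integrableB measurableT (iphi j.+1) (iphi j); exact: eq_integrable.
  apply: le_trans (sq_norm_kernel_transform id) _.
  rewrite -mulrA EFinM lee_wpmul2l ?lee_fin//.
  pose d1 n x := v x - phi n x.
  have md n : measurable_fun setT (d1 n) by exact: measurable_funB.
  rewrite (_ : (fun y => _) = (fun y => d1 j y + (-1) * d1 j.+1 y)); last first.
    by apply/funext => y; rewrite /d1; ring.
  apply: le_trans (sq_normD m (@ltr01 R) _ _) _ => //.
    exact: measurable_funM.
  rewrite sq_normZ// sqrrN expr1n mul1e.
  apply: (@le_trans _ _ ((1 + 1)%:E * (16%:R^-1 ^+ j)%:E +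
      (1 + 1^-1)%:E * (16%:R^-1 ^+ j.+1)%:E)%E).
    by apply: leeD; apply: lee_wpmul2l; rewrite ?lee_fin ?invr1//; exact: phi2.
  rewrite -!EFinM -EFinD lee_fin exprS invr1.
  have : 0 <= 16%:R^-1 ^+ j :> R by rewrite exprn_ge0// invr_ge0.
  by lra.
exists W; split => //.
  apply: (@fatou_bound _ _ _ m (fun j x => Hk (phi j) x ^+ 2)) => //.
  - by move=> j; exact: measurable_funX.
  - by move=> j x; exact: sqr_ge0.
  - exact: measurable_funX.
  - by move=> x; exact: sqr_ge0.
  - by apply: filterS Wcvg => x Wx; exact: (cvgM Wx Wx).
move=> f M jf fM fcvg.
have mf := integrable_measurable jf.
have f2 : (sq_norm m f < +oo)%E.
  apply: integrable_lty => //.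
  have := integrable_bounded mf fM jf.
  by apply: eq_integrable.
have mHf := measurable_kernel_transform mf.
have Hf2 : (sq_norm m (Hk f) < +oo)%E.
  apply: le_lt_trans (sq_norm_kernel_transform jf) _.
  by rewrite lte_mul_pinfty// lee_fin.
(* The pairing with a square-integrable function passes to the limit, being
   dominated by E times that function. *)
have lim (g : T -> R) : measurable_fun setT g -> (sq_norm m g < +oo)%E ->
    m.-integrable setT (EFin \o (fun x => W x * g x)) /\
    \int[m]_x (Hk (phi j) x * g x) @[j --> \oo] --> \int[m]_x (W x * g x).
  move=> mg g2; apply: (@Rdominated_cvg _ _ _ m _ _ (fun x => E x * `|g x|)).
  - by move=> j; exact: measurable_funM.
  - exact: measurable_funM.
  - by apply: filterS Wcvg => x Wx; apply: cvgM => //; exact: cvg_cst.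
  - apply: integrable_sq_prod => //; first exact: measurableT_comp.
    apply: le_lt_trans g2; apply: le_sq_norm => //; first exact: measurableT_comp.
    by move=> x; rewrite normr_id.
  - by apply: filterS EH => x Ex j; rewrite normrM ler_wpM2r.
have limv (g : T -> R) : measurable_fun setT g -> (sq_norm m g < +oo)%E ->
    \int[m]_x (phi j x * g x) @[j --> \oo] --> \int[m]_x (v x * g x).
  move=> mg g2.
  apply: (proj2 (@Rdominated_cvg _ _ _ m _ _ (fun x => `|v x * g x|) _ _ _ _ _)).
  - by move=> j; exact: measurable_funM.
  - exact: measurable_funM.
  - by apply: aeW => x; apply: cvgM => //; exact: cvg_cst.
  - by apply: integrable_norm; exact: integrable_sq_prod.
  - by apply: aeW => x j; rewrite !normrM ler_wpM2r.
have [iWf cWf] := lim f mf f2.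
have [iWH cWH] := lim _ mHf Hf2.
split => //.
  apply: (cvg_unique _ cWf) => //.
  rewrite (_ : (fun j => _) = (fun j => \int[m]_x (phi j x * Hk f x))).
    exact: limv.
  by apply/funext => j; rewrite kernel_transform_dual.
(* The inversion formula holds for each phi j: its damped version is the pairing
   of phi j with regularize n f, which tends to c times the pairing with f. *)
apply: (cvg_unique _ cWH) => //.
rewrite (_ : (fun j => _) = (fun j => c * \int[m]_x (phi j x * f x))).
  by apply: cvgM (limv _ mf f2); exact: cvg_cst.
apply/funext => j.
have HH : m.-integrable setT (EFin \o (fun x => Hk (phi j) x * Hk f x)).
  apply: (integrable_sq_prod (mH j) mHf _ Hf2).
  exact: le_lt_trans (Hphi2 j) cvfin.
have [|||||_ c1] := @Rdominated_cvg _ _ _ m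
    (fun n q => K n q * (Hk (phi j) q * Hk f q))
    (fun q => Hk (phi j) q * Hk f q) (fun q => `|Hk (phi j) q * Hk f q|).
- move=> n; apply: measurable_funM; first exact: integrable_measurable (iK n).
  exact: measurable_funM.
- exact: measurable_funM.
- apply: aeW => q; rewrite -[X in _ --> X]mul1r.
  by apply: cvgM => //; exact: cvg_cst.
- exact: integrable_norm.
- by apply: aeW => q n; rewrite normrM ler_piMl// ger0_norm.
apply: (cvg_unique _ c1) => //.
rewrite (_ : (fun n => _) = (fun n => \int[m]_x (phi j x * regularize n f x))).
  have iphif : m.-integrable setT (EFin \o (fun x => phi j x * f x)).
    have := integrable_bounded mf fM (iphi j).
    by apply: eq_integrable => // x _ /=; rewrite mulrC.
  rewrite -RintegralZl//.
  apply: (proj2 (@Rdominated_cvg _ _ _ m _ _ (fun x => (c * M) * `|phi j x|) _ _ _ _ _)).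
  - move=> n; apply: measurable_funM => //.
    apply: (@measurable_parametric_Rintegral _ _ _ _ _ m (fun z => G n z * f z.2)).
    by apply: measurable_funM => //; exact: measurableT_comp.
  - by apply: measurable_funM => //; exact: measurable_funM.
  - apply: aeW => x; rewrite mulrCA; apply: cvgM => //; exact: cvg_cst.
  - have := integrableZl measurableT (c * M) (integrable_norm (iphi j)).
    exact: eq_integrable.
  - apply: aeW => x n; rewrite normrM mulrC ler_wpM2r//.
    exact: regularize_bounded.
by apply/funext => n; rewrite kernel_transform_dual_regularized.
Qed.

End bounded_kernel.

(** * Changes of variables that scale a measure *)

Section quasi_invariance.
Context d (T : measurableType d) (R : realType).
Variable m : {measure set T -> \bar R}.

(** The image of m by phi, multiplied by c, is m; for a diffeomorphism of R^n and
    Lebesgue measure, phi has constant Jacobian c. *)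
Definition rescales (phi : T -> T) (c : R) :=
  forall A, measurable A -> (m A = c%:E * m (phi @^-1` A))%E.

Variables (phi : T -> T) (c : R).
Hypotheses (mphi : measurable_fun setT phi) (c0 : 0 <= c)
  (mphiE : rescales phi c).

Lemma ge0_integral_rescale (f : T -> \bar R) :
  measurable_fun setT f -> (forall x, 0 <= f x)%E ->
  (\int[m]_x f x = c%:E * \int[m]_x f (phi x))%E.
Proof.
move=> mf f0.
pose pm := [the measure _ _ of pushforward m phi].
rewrite (@eq_measure_integral _ _ _ _ (mscale (NngNum c0) (pm mphi))); last first.
  by move=> A mA _; rewrite mphiE.
rewrite ge0_integral_mscale//; congr *%E.
by rewrite ge0_integral_pushforward.
Qed.

Lemma integrable_rescale (f : T -> R) : 0 < c ->
  m.-integrable setT (EFin \o f) ->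
  m.-integrable setT (EFin \o (fun x => f (phi x))).
Proof.
move=> cgt0 /integrableP[mf intf]; apply/integrableP; split.
  exact: (measurableT_comp mf mphi).
move: intf; rewrite ge0_integral_rescale//; last exact: measurableT_comp.
by rewrite !ltey; apply: contra => /eqP ->; rewrite gt0_muley ?lte_fin.
Qed.

Lemma Rintegral_rescale (f : T -> R) :
  0 < c -> m.-integrable setT (EFin \o f) ->
  \int[m]_x f x = c * \int[m]_x f (phi x).
Proof.
move=> cgt0 intf.
have if2 := integrable_rescale cgt0 intf.
have mf := measurable_int _ intf.
rewrite /Rintegral (_ : c = fine c%:E)// -fineM//; last exact: integrable_fin_num.
congr fine; rewrite integralE [X in (_ = _ * X)%E]integralE.
rewrite (ge0_integral_rescale (measurable_funepos mf))//.
rewrite (ge0_integral_rescale (measurable_funeneg mf))//.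
rewrite [RHS]muleBr//; last first.
  by apply: fin_num_adde_defr; exact: integrable_pos_fin_num if2.
congr (_ * _ - _ * _)%E; apply: eq_integral => x _.
  by rewrite !funeposE.
by rewrite !funenegE.
Qed.

End quasi_invariance.

Section quasi_invariance_product.
Context d1 d2 (T1 : measurableType d1) (T2 : measurableType d2) (R : realType).
Variables (m1 : {sigma_finite_measure set T1 -> \bar R})
          (m2 : {sigma_finite_measure set T2 -> \bar R}).

Lemma rescales_prod (phi1 : T1 -> T1) (phi2 : T2 -> T2) (c1 c2 : R) :
  measurable_fun setT phi1 -> measurable_fun setT phi2 ->
  0 <= c1 -> 0 <= c2 -> rescales m1 phi1 c1 -> rescales m2 phi2 c2 ->
  rescales (m1 \x m2)%E (fun z => (phi1 z.1, phi2 z.2)) (c1 * c2).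
Proof.
move=> mphi1 mphi2 c10 c20 r1 r2.
have mphi : measurable_fun setT (fun z : T1 * T2 => (phi1 z.1, phi2 z.2)).
  by apply: measurable_fun_pair; exact: measurableT_comp.
pose pm := [the measure _ _ of pushforward (m1 \x m2)%E (fun z => (phi1 z.1, phi2 z.2))].
move=> A mA.
apply: (@product_measure_unique _ _ _ _ _ m1 m2
  (mscale (NngNum (mulr_ge0 c10 c20)) (pm mphi))) => // B C mB mC.
rewrite [LHS](_ : _ = (c1 * c2)%:E * (m1 \x m2) ((phi1 @^-1` B) `*` (phi2 @^-1` C)))%E//.
have mB' : measurable (phi1 @^-1` B) by rewrite -[X in measurable X]setTI; exact: mphi1.
have mC' : measurable (phi2 @^-1` C) by rewrite -[X in measurable X]setTI; exact: mphi2.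
by rewrite product_measure1E// EFinM muleACA -r1// -r2.
Qed.

End quasi_invariance_product.

Section product_sigma_finite.
Context d1 d2 (T1 : measurableType d1) (T2 : measurableType d2) (R : realType).
Variables (m1 : {sigma_finite_measure set T1 -> \bar R})
          (m2 : {sigma_finite_measure set T2 -> \bar R}).

(** The product of two sigma-finite measures, itself a sigma-finite measure, so
    that products can be iterated. *)
Definition product_measure : set (T1 * T2) -> \bar R := (m1 \x m2)%E.

HB.instance Definition _ := Measure.copy product_measure (m1 \x m2)%E.

Let product_measure_sigma_finite : sigma_finite setT product_measure.
Proof.
have /sigma_finiteP[F [TF ndF Foo]] := sigma_finiteT m1.
have /sigma_finiteP[G [TG ndG Goo]] := sigma_finiteT m2.
exists (fun n => F n `*` G n).
  apply/seteqP; split => [[x y] _|//].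
  have [i _ Fx] : (\bigcup_n F n) x by rewrite -TF.
  have [j _ Gy] : (\bigcup_n G n) y by rewrite -TG.
  exists (maxn i j) => //; split => /=.
    by apply: (subsetPset _ _ (ndF _ _ (leq_maxl i j))).
  by apply: (subsetPset _ _ (ndG _ _ (leq_maxr i j))).
move=> n; have [mF Fn] := Foo n; have [mG Gn] := Goo n.
split; first exact: measurableX.
rewrite [X in (X < _)%E]product_measure1E//.
by rewrite lte_mul_pinfty// ge0_fin_numE.
Qed.

HB.instance Definition _ := Measure_isSigmaFinite.Build _ _ _ product_measure
  product_measure_sigma_finite.

End product_sigma_finite.

(** * Affine changes of variables for Lebesgue measure *)

Section affine_lebesgue.
Context {R : realType}.
Implicit Types (a b : R) (x : R3 R).

Lemma rescales_lebesgue a b : 0 < a ->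
  rescales (@lebesgue_measure R) (fun x : measurableTypeR R => b + a * x) a.
Proof.
move=> a0 A mA; pose phi (x : measurableTypeR R) : measurableTypeR R := b + a * x.
have mphi : measurable_fun setT (phi : measurableTypeR R -> measurableTypeR R).
  by apply: measurable_funD => //; exact: measurable_funM.
pose pm := [the measure _ _ of pushforward (@lebesgue_measure R)
  (phi : measurableTypeR R -> measurableTypeR R)].
apply: (@lebesgue_measure_unique _
  (mscale (NngNum (ltW a0)) (pm mphi))) => // _ [[u v]] _ <-.
rewrite [RHS](_ : _ = a%:E * lebesgue_measure (phi @^-1` `]u, v]))%E//.
rewrite (_ : phi @^-1` `]u, v]%classic = `](u - b) / a, (v - b) / a]%classic); last first.
  apply/seteqP; split => x; rewrite /phi /= !in_itv/= ltr_pdivrMr// ler_pdivlMr//;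
    rewrite ltrBlDl lerBrDl (mulrC x).
    by [].
  by [].
rewrite !lebesgue_measure_itv/= !lte_fin ltr_pM2r ?invr_gt0// ltrD2r.
case: ifP => _; last by rewrite mule0.
by rewrite -EFinB -EFinM; congr EFin; field; rewrite gt_eqF.
Qed.

Lemma rescales_lebesgue_opp :
  rescales (@lebesgue_measure R) (fun x : measurableTypeR R => - x) 1.
Proof. by move=> A mA; rewrite mul1e; exact: (esym (lebesgue_measureN mA)). Qed.

(** Lebesgue measure on the plane and in space, as sigma-finite measures. *)
Definition leb2 : {sigma_finite_measure set (measurableTypeR R * measurableTypeR R)%type -> \bar R} :=
  product_measure (@lebesgue_measure R) (@lebesgue_measure R).

Definition leb3 : {sigma_finite_measure set (mR3 R) -> \bar R} :=
  product_measure leb2 (@lebesgue_measure R).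

Lemma leb3E : (leb3 : {measure set (mR3 R) -> \bar R}) = lebesgue3.
Proof. by []. Qed.

End affine_lebesgue.

(** * The Poisson kernel on the line *)

Section poisson_kernel_line.
Context {R : realType}.
Local Notation mu := (@lebesgue_measure R).
Implicit Types e t x A : R.

(** The two-sided exponential and its Fourier transform, the Poisson kernel,
    normalized to have mass 2 pi. *)
Definition damping e t := expR (- e * `|t|).
Definition poisson e x := 2 * e / (e ^+ 2 + x ^+ 2).

(** A primitive of (1 + cos(t x)) exp(-e t).  The constant 1 makes the integrand
    nonnegative, as the fundamental theorem of calculus on a half-line used
    below requires. *)
Lemma derive_damped_cos e x t : 0 < e ->
  is_derive t 1 (fun t => expR (- e * t) *
     ((- e * cos (t * x) + x * sin (t * x)) / (e ^+ 2 + x ^+ 2) - e^-1))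
    ((1 + cos (t * x)) * expR (- e * t)).
Proof.
move=> e0.
have h1 : is_derive t 1 (fun t => expR (- e * t)) (- e * expR (- e * t)).
  by apply: is_derive_eq; rewrite /GRing.scale/=; ring.
have h2 : is_derive t 1 (fun t => cos (t * x)) (- x * sin (t * x)).
  by apply: is_derive_eq; rewrite /GRing.scale/=; ring.
have h3 : is_derive t 1 (fun t => sin (t * x)) (x * cos (t * x)).
  by apply: is_derive_eq; rewrite /GRing.scale/=; ring.
apply: is_derive_eq; rewrite /GRing.scale/=.
field; rewrite gt_eqF//= gt_eqF// ltr_wpDr ?sqr_ge0// exprn_gt0//.
Qed.

Lemma continuous_damping e : continuous (damping e).
Proof.
move=> t; apply: continuous_comp; last exact: continuous_expR.
by apply: cvgM; [exact: cvg_cst|exact: norm_continuous].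
Qed.

Lemma poisson_ge0 e x : 0 < e -> 0 <= poisson e x.
Proof.
by move=> e0; rewrite divr_ge0 ?mulr_ge0 ?(ltW e0)// addr_ge0// sqr_ge0.
Qed.

Lemma integral_cos_damping_half e x : 0 < e ->
  (\int[mu]_(t in `[0%R, +oo[) ((1 + cos (t * x)) * expR (- e * t))%:E =
   (e / (e ^+ 2 + x ^+ 2) + e^-1)%:E)%E.
Proof.
move=> e0.
have d0 : 0 < e ^+ 2 + x ^+ 2 by rewrite ltr_wpDr ?sqr_ge0// exprn_gt0.
pose G t := (- e * cos (t * x) + x * sin (t * x)) / (e ^+ 2 + x ^+ 2) - e^-1.
pose F t := expR (- e * t) * G t.
have dF t := derive_damped_cos x t e0.
have cF : continuous F.
  by move=> t; apply/differentiable_continuous/derivable1_diffP; exact: (@ex_derive _ _ _ _ _ _ _ (dF t)).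
rewrite (@ge0_continuous_FTC2y _ _ F 0 0).
- rewrite /F /G mulr0 expR0 !mul0r cos0 sin0 -EFinB; congr EFin; field.
  by rewrite !gt_eqF.
- by move=> t _; rewrite mulr_ge0 ?expR_ge0// -lerBlDl sub0r cos_geN1.
- apply: continuous_subspaceT => t; apply: cvgM.
    apply: cvgD; first exact: cvg_cst.
    apply: continuous_comp; last exact: continuous_cos.
    by apply: cvgM; [exact: cvg_id|exact: cvg_cst].
  apply: continuous_comp; last exact: continuous_expR.
  by apply: cvgM; [exact: cvg_cst|exact: cvg_id].
- pose C := (e + `|x|) / (e ^+ 2 + x ^+ 2) + e^-1.
  have GC t : `|G t| <= C.
    apply: le_trans (ler_normB _ _) _.
    have ie : `|e^-1| = e^-1 by rewrite ger0_norm// invr_ge0 ltW.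
    have id : `|(e ^+ 2 + x ^+ 2)^-1| = (e ^+ 2 + x ^+ 2)^-1.
      by rewrite ger0_norm// invr_ge0 ltW.
    rewrite ie lerD2r normrM id ler_wpM2r ?invr_ge0 ?(ltW d0)//.
    apply: le_trans (ler_normD _ _) _; rewrite !normrM normrN.
    rewrite (ger0_norm (ltW e0)) lerD//.
      by rewrite ler_piMr ?(ltW e0)// ler_norml cos_geN1 cos_le1.
    by rewrite ler_piMr// ler_norml sin_geN1 sin_le1.
  have e1 : expR (- e * t) @[t --> +oo] --> (0 : R).
    rewrite (_ : (fun t => expR (- e * t)) =
                 (fun z => expR (- z)) \o (fun z => e * z)); last first.
      by apply: eq_fun => t; rewrite mulNr.
    apply: (@cvg_comp _ _ _ _ _ _ (pinfty_nbhs R)); last exact: cvgr_expR.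
    exact: gt0_cvgMry.
  apply: (@squeeze_cvgr _ _ _ _ (fun t => - C * expR (- e * t)) (fun t => C * expR (- e * t))).
  + apply: nearW => t; rewrite /F.
    rewrite mulNr -ler_norml normrM ger0_norm ?expR_ge0// mulrC.
    by rewrite ler_wpM2r ?expR_ge0.
  + by rewrite -[X in _ --> X](mulr0 (- C)); apply: cvgM => //; exact: cvg_cst.
  + by rewrite -[X in _ --> X](mulr0 C); apply: cvgM => //; exact: cvg_cst.
- by move=> t _; exact: (@ex_derive _ _ _ _ _ _ _ (dF t)).
- by apply: cvg_at_right_filter; exact: cF.
- by move=> t _; rewrite derive1E; exact: (@derive_val _ _ _ _ _ _ _ (dF t)).
Qed.

Lemma integral_cos_damping e x : 0 < e ->
  (\int[mu]_t ((1 + cos (t * x)) * damping e t)%:E =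
   (poisson e x + 2 * e^-1)%:E)%E.
Proof.
move=> e0; rewrite ge0_symfun_integralT//.
- rewrite (_ : [set t | _] = `[0, +oo[%classic); last first.
    by apply/seteqP; split => t/=; rewrite in_itv/= andbT.
  have -> : (\int[mu]_(t in `[0%R, +oo[) ((1 + cos (t * x)) * damping e t)%:E =
      \int[mu]_(t in `[0%R, +oo[) ((1 + cos (t * x)) * expR (- e * t))%:E)%E.
    apply: eq_integral => t; rewrite inE/= in_itv/= andbT => t0.
    by rewrite /damping ger0_norm.
  by rewrite integral_cos_damping_half// -EFinM; congr EFin; rewrite /poisson; ring.
- by move=> t; rewrite mulr_ge0 ?expR_ge0// -lerBlDl sub0r cos_geN1.
- move=> t; apply: cvgM; last exact: continuous_damping.
  apply: cvgD; first exact: cvg_cst.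
  apply: continuous_comp; last exact: continuous_cos.
  by apply: cvgM; [exact: cvg_id|exact: cvg_cst].
- by move=> t; rewrite /= /damping normrN (mulNr t) cosN.
Qed.

Lemma measurable_damping e : measurable_fun setT (damping e).
Proof. exact: continuous_measurable_fun (@continuous_damping e). Qed.

Lemma integral_damping e : 0 < e ->
  (\int[mu]_t (damping e t)%:E = (2 * e^-1)%:E)%E.
Proof.
move=> e0; have := integral_cos_damping 0 e0.
rewrite (eq_integral (fun t : measurableTypeR R => 2%:E * (damping e t)%:E)%E); last first.
  by move=> t _; rewrite mulr0 cos0.
rewrite ge0_integralZl//; first last.
- by move=> t _; rewrite lee_fin expR_ge0.
- by apply/measurable_EFinP; exact: measurable_damping.
rewrite (_ : poisson e 0 + 2 * e^-1 = 2 * (2 * e^-1)); last first.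
  by rewrite /poisson; field; rewrite gt_eqF.
rewrite EFinM => /(congr1 (fun y => 2^-1%:E * y)%E).
by rewrite !muleA -(EFinM 2^-1) mulVf// !mul1e.
Qed.

Lemma integrable_damping e : 0 < e -> mu.-integrable setT (EFin \o damping e).
Proof.
move=> e0; apply/integrableP; split.
  by apply/measurable_EFinP; exact: measurable_damping.
rewrite (eq_integral (fun t : measurableTypeR R => (damping e t)%:E)).
  by rewrite integral_damping// ltry.
by move=> t _ /=; rewrite ger0_norm// expR_ge0.
Qed.

(** The phase A allows the integrals over the three coordinates to be computed
    one after the other. *)
Lemma Rintegral_damping_cos e x A : 0 < e ->
  \int[mu]_t (cos (A + t * x) * damping e t) = cos A * poisson e x.
Proof.
move=> e0.
have mc : measurable_fun setT (fun t : measurableTypeR R => cos (t * x)).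
  apply: continuous_measurable_fun => t.
  apply: continuous_comp; last exact: continuous_cos.
  by apply: cvgM; [exact: cvg_id|exact: cvg_cst].
have ms : measurable_fun setT (fun t : measurableTypeR R => sin (t * x)).
  apply: continuous_measurable_fun => t.
  apply: continuous_comp; last exact: continuous_sin.
  by apply: cvgM; [exact: cvg_id|exact: cvg_cst].
have ic : mu.-integrable setT (EFin \o (fun t => cos (t * x) * damping e t)).
  apply: (@integrable_bounded _ _ _ _ _ _ 1 mc _ (integrable_damping e0)).
  by move=> t; rewrite ler_norml cos_geN1 cos_le1.
have is_ : mu.-integrable setT (EFin \o (fun t => sin (t * x) * damping e t)).
  apply: (@integrable_bounded _ _ _ _ _ _ 1 ms _ (integrable_damping e0)).
  by move=> t; rewrite ler_norml sin_geN1 sin_le1.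
have -> : \int[mu]_t (cos (A + t * x) * damping e t) =
    cos A * \int[mu]_t (cos (t * x) * damping e t) -
    sin A * \int[mu]_t (sin (t * x) * damping e t).
  rewrite -!RintegralZl// -RintegralB//.
  - by apply: eq_Rintegral => t _; rewrite cosD; ring.
  - exact: (integrableZl measurableT (cos A) ic).
  - exact: (integrableZl measurableT (sin A) is_).
have -> : \int[mu]_t (sin (t * x) * damping e t) = 0.
  have : \int[mu]_t (sin (t * x) * damping e t) = - \int[mu]_t (sin (t * x) * damping e t).
    have mo : measurable_fun setT (fun t : measurableTypeR R => - t).
      by apply: continuous_measurable_fun => t; exact: opp_continuous.
    rewrite [LHS](Rintegral_rescale mo ler01 rescales_lebesgue_opp ltr01 is_).
    rewrite mul1r -mulN1r -RintegralZl//.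
    by apply: eq_Rintegral => t _; rewrite /damping normrN (mulNr t) sinN; ring.
  by lra.
rewrite mulr0 subr0; congr *%R.
have := integral_cos_damping x e0.
have -> : poisson e x + 2 * e^-1 = \int[mu]_t (damping e t) + poisson e x.
  by rewrite /Rintegral integral_damping// addrC.
move=> /(congr1 fine)/=.
rewrite -[LHS]/(\int[mu]_t ((1 + cos (t * x)) * damping e t)).
under eq_Rintegral do rewrite mulrDl mul1r.
by rewrite RintegralD//; [move/addrI|exact: integrable_damping].
Qed.

Lemma poisson_scale e x : 0 < e -> poisson e x = e^-1 * poisson 1 (e^-1 * x).
Proof.
move=> e0; rewrite /poisson; field.
rewrite gt_eqF//= ?gt_eqF//= ltr_wpDr ?sqr_ge0// exprn_gt0//.
Qed.

Lemma poisson1E x : poisson 1 x = 2 * (oneDsqr x)^-1.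
Proof. by rewrite /poisson /oneDsqr expr1n mulr1. Qed.

Lemma continuous_poisson1 : continuous (@poisson 1).
Proof.
rewrite (_ : poisson 1 = fun x => 2 * (oneDsqr x)^-1).
  by move=> x; apply: cvgM; [exact: cvg_cst|exact: continuous_oneDsqrV].
by apply/funext => x; exact: poisson1E.
Qed.

Lemma integrable_poisson1 : mu.-integrable setT (EFin \o poisson 1).
Proof.
have io : mu.-integrable setT (EFin \o (fun x : R => (oneDsqr x)^-1)).
  apply/integrableP; split.
    apply/measurable_EFinP.
    exact: (continuous_measurable_fun (@continuous_oneDsqrV R)).
  have -> : (\int[mu]_x `|(EFin \o (fun x => (oneDsqr x)^-1)%R) x| =
             \int[mu]_x ((oneDsqr x)^-1%R)%:E)%E.
    apply: eq_integral => x _ /=.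
    by rewrite ger0_norm// invr_ge0 (le_trans ler01 (oneDsqr_ge1 _)).
  rewrite ge0_symfun_integralT.
  - rewrite (_ : [set t | _] = `[0, +oo[%classic); last first.
      by apply/seteqP; split => t/=; rewrite in_itv/= andbT.
    by rewrite integral0y_oneDsqr -EFinM ltry.
  - by move=> x; rewrite invr_ge0 (le_trans ler01 (oneDsqr_ge1 _)).
  - exact: continuous_oneDsqrV.
  - by move=> x; rewrite /= /oneDsqr sqrrN.
have := integrableZl measurableT 2 io.
by apply: eq_integrable => // x _ /=; rewrite poisson1E.
Qed.

End poisson_kernel_line.

(** * The Poisson kernel and the cosine-sine kernel in space *)

Section product_Rintegral.
Context d1 d2 (T1 : measurableType d1) (T2 : measurableType d2) (R : realType).
Variables (m1 : {sigma_finite_measure set T1 -> \bar R})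
          (m2 : {sigma_finite_measure set T2 -> \bar R}).

Lemma Rintegral_product (F : T1 * T2 -> R) :
  (m1 \x m2)%E.-integrable setT (EFin \o F) ->
  (forall x, m2.-integrable setT (EFin \o (fun y => F (x, y)))) ->
  \int[(m1 \x m2)%E]_z F z = \int[m1]_x (\int[m2]_y F (x, y)).
Proof.
move=> iF iF1; congr fine; rewrite -(integral12_prod_meas1 iF).
by apply: eq_integral => x _; rewrite fineK//; exact: integrable_fin_num (iF1 x).
Qed.

End product_Rintegral.

Section poisson_kernel_space.
Context {R : realType}.
Implicit Types (e A : R) (x y q : R3 R).

Lemma dotE x y : dot x y = x.1.1 * y.1.1 + x.1.2 * y.1.2 + x.2 * y.2.
Proof. by rewrite /dot !big_ord_recl big_ord0 /coord3/= addr0 addrA. Qed.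

(** Products of the one-dimensional kernels in the three coordinates. *)
Definition damping3 e q := damping e q.1.1 * damping e q.1.2 * damping e q.2.
Definition poisson3 e x := poisson e x.1.1 * poisson e x.1.2 * poisson e x.2.

Lemma integrable_damping2 e : 0 < e ->
  (@leb2 R).-integrable setT (EFin \o (fun p => damping e p.1 * damping e p.2)).
Proof.
by move=> e0; apply: integrable_tensor; exact: integrable_damping.
Qed.

Lemma integrable_damping3 e : 0 < e ->
  (@leb3 R).-integrable setT (EFin \o damping3 e).
Proof.
move=> e0; have := integrable_tensor (integrable_damping2 e0) (integrable_damping e0).
exact.
Qed.

Lemma measurable_coords :
  [/\ measurable_fun setT (fun x : mR3 R => x.1.1 : measurableTypeR R),
      measurable_fun setT (fun x : mR3 R => x.1.2 : measurableTypeR R) &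
      measurable_fun setT (fun x : mR3 R => x.2 : measurableTypeR R)].
Proof.
split; last exact: measurable_snd.
- exact: (measurableT_comp measurable_fst measurable_fst).
- exact: (measurableT_comp measurable_snd measurable_fst).
Qed.

Lemma measurable_dot d (T : measurableType d) (f g : T -> mR3 R) :
  measurable_fun setT f -> measurable_fun setT g ->
  measurable_fun setT (fun t => dot (f t) (g t)).
Proof.
move=> mf mg; have [m1 m2 m3] := measurable_coords.
rewrite (_ : (fun t => _) = fun t => (f t).1.1 * (g t).1.1 +
    (f t).1.2 * (g t).1.2 + (f t).2 * (g t).2); last first.
  by apply/funext => t; rewrite dotE.
apply: measurable_funD; first apply: measurable_funD.
- exact: measurable_funM (measurableT_comp m1 mf) (measurableT_comp m1 mg).
- exact: measurable_funM (measurableT_comp m2 mf) (measurableT_comp m2 mg).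
- exact: measurable_funM (measurableT_comp m3 mf) (measurableT_comp m3 mg).
Qed.

Lemma measurable_cos_comp d (T : measurableType d) (f : T -> R) :
  measurable_fun setT f -> measurable_fun setT (fun t => cos (f t)).
Proof.
move=> mf; apply: (measurableT_comp _ mf).
exact: (continuous_measurable_fun (@continuous_cos R)).
Qed.

Lemma measurable_sin_comp d (T : measurableType d) (f : T -> R) :
  measurable_fun setT f -> measurable_fun setT (fun t => sin (f t)).
Proof.
move=> mf; apply: (measurableT_comp _ mf).
exact: (continuous_measurable_fun (@continuous_sin R)).
Qed.

Lemma norm_cos_le1 (t : R) : `|cos t| <= 1.
Proof. by rewrite ler_norml cos_geN1 cos_le1. Qed.

Lemma norm_sin_le1 (t : R) : `|sin t| <= 1.
Proof. by rewrite ler_norml sin_geN1 sin_le1. Qed.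

Lemma integrable_cos_damping3 e A x : 0 < e ->
  (@leb3 R).-integrable setT (EFin \o (fun q => cos (A + dot q x) * damping3 e q)).
Proof.
move=> e0; apply: (@integrable_bounded _ _ _ _ _ _ 1) => //.
- by apply: measurable_cos_comp; apply: measurable_funD => //; exact: measurable_dot.
- by move=> q; exact: norm_cos_le1.
- exact: integrable_damping3.
Qed.

Lemma Rintegral_cos_damping3 e A x : 0 < e ->
  \int[@leb3 R]_q (cos (A + dot q x) * damping3 e q) = cos A * poisson3 e x.
Proof.
move=> e0.
have bnd (B C y : R) :
    (@lebesgue_measure R).-integrable setT
     (EFin \o (fun t : measurableTypeR R => cos (B + t * y) * (C * damping e t))).
  apply: (@integrable_bounded _ _ _ _ _ _ 1).
  - apply: measurable_cos_comp; apply: measurable_funD => //.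
    exact: measurable_funM.
  - by move=> q; exact: norm_cos_le1.
  - have := integrableZl measurableT C (integrable_damping e0).
    exact: eq_integrable.
have i2 : (@leb2 R).-integrable setT (EFin \o (fun p =>
    cos (A + p.1 * x.1.1 + p.2 * x.1.2) * (damping e p.1 * damping e p.2))).
  apply: (@integrable_bounded _ _ _ _ _ _ 1).
  - apply: measurable_cos_comp; apply: measurable_funD.
      by apply: measurable_funD => //; exact: measurable_funM.
    exact: measurable_funM.
  - by move=> q; exact: norm_cos_le1.
  - exact: integrable_damping2.
rewrite [LHS](Rintegral_product (integrable_cos_damping3 A x e0)); last first.
  move=> p; have := bnd (A + p.1 * x.1.1 + p.2 * x.1.2)
    (damping e p.1 * damping e p.2) x.2.
  by apply: eq_integrable => // t _; rewrite /= dotE/= !addrA.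
rewrite (_ : \int[leb2]_p _ = \int[@leb2 R]_p (poisson e x.2 *
    (cos (A + p.1 * x.1.1 + p.2 * x.1.2) * (damping e p.1 * damping e p.2)))); last first.
  apply: eq_Rintegral => p _.
  transitivity (\int[@lebesgue_measure R]_t (damping e p.1 * damping e p.2 *
     (cos ((A + p.1 * x.1.1 + p.2 * x.1.2) + t * x.2) * damping e t))).
    apply: eq_Rintegral => t _; rewrite dotE/= /damping3/= !addrA; ring.
  rewrite RintegralZl//; last first.
    have := bnd (A + p.1 * x.1.1 + p.2 * x.1.2) 1 x.2.
    by apply: eq_integrable => // t _; rewrite /= mul1r.
  by rewrite Rintegral_damping_cos//; ring.
rewrite RintegralZl//.
rewrite [X in _ * X = _](Rintegral_product i2); last first.
  move=> s; have := bnd (A + s * x.1.1) (damping e s) x.1.2.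
  by apply: eq_integrable.
rewrite (_ : \int[lebesgue_measure]_s _ = \int[@lebesgue_measure R]_s (poisson e x.1.2 *
    (cos (A + s * x.1.1) * damping e s))); last first.
  apply: eq_Rintegral => s _ /=.
  transitivity (\int[@lebesgue_measure R]_t (damping e s *
     (cos ((A + s * x.1.1) + t * x.1.2) * damping e t))).
    by apply: eq_Rintegral => t _; ring.
  rewrite RintegralZl//; last first.
    have := bnd (A + s * x.1.1) 1 x.1.2.
    by apply: eq_integrable => // t _; rewrite /= mul1r.
  by rewrite Rintegral_damping_cos//; ring.
rewrite RintegralZl//; last first.
  have := bnd A 1 x.1.1.
  by apply: eq_integrable => // t _; rewrite /= mul1r.
by rewrite Rintegral_damping_cos// /poisson3; ring.
Qed.

Lemma Rintegral_sin_damping3 e x : 0 < e ->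
  \int[@leb3 R]_q (sin (dot q x) * damping3 e q) = 0.
Proof.
(* sin t = cos (t - pi / 2) *)
move=> e0; have := Rintegral_cos_damping3 (- (pi / 2)) x e0.
rewrite cosN cos_pihalf mul0r => <-; apply: eq_Rintegral => q _.
by rewrite addrC cosB cos_pihalf sin_pihalf mulr0 add0r mulr1.
Qed.

(** The kernel cos + sin of the Hartley transform on R^3. *)
Definition cas3 (z : mR3 R * mR3 R) : R := cos (dot z.1 z.2) + sin (dot z.1 z.2).

Lemma measurable_cas3 : measurable_fun setT cas3.
Proof.
by apply: measurable_funD; [apply: measurable_cos_comp|apply: measurable_sin_comp];
  exact: measurable_dot.
Qed.

Lemma cas3_bounded z : `|cas3 z| <= 2.
Proof.
by apply: le_trans (ler_normD _ _) _; rewrite -[2]/(1 + 1) lerD// ?norm_cos_le1// norm_sin_le1.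
Qed.

Lemma dotC x y : dot x y = dot y x.
Proof. by rewrite !dotE; ring. Qed.

Lemma cas3C x y : cas3 (x, y) = cas3 (y, x).
Proof. by rewrite /cas3/= dotC. Qed.

Lemma cas3M x y q :
  cas3 (x, q) * cas3 (y, q) = cos (dot q (x - y)) + sin (dot q (x + y)).
Proof.
rewrite /cas3/= (_ : dot q (x - y) = dot x q - dot y q); last first.
  by rewrite !dotE/=; ring.
rewrite (_ : dot q (x + y) = dot x q + dot y q); last first.
  by rewrite !dotE/=; ring.
by rewrite cosB sinD; ring.
Qed.

(** The damped square of the Hartley transform is convolution with the Poisson
    kernel. *)
Lemma Rintegral_cas3M_damping3 e x y : 0 < e ->
  \int[@leb3 R]_q (cas3 (x, q) * cas3 (y, q) * damping3 e q) = poisson3 e (x - y).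
Proof.
move=> e0; transitivity (\int[@leb3 R]_q (cos (0 + dot q (x - y)) * damping3 e q +
    sin (dot q (x + y)) * damping3 e q)).
  by apply: eq_Rintegral => q _; rewrite cas3M mulrDl add0r.
rewrite RintegralD//; last first.
  apply: (@integrable_bounded _ _ _ _ _ _ 1).
  - by apply: measurable_sin_comp; exact: measurable_dot.
  - by move=> q; exact: norm_sin_le1.
  - exact: integrable_damping3.
  exact: integrable_cos_damping3.
by rewrite Rintegral_cos_damping3// Rintegral_sin_damping3// cos0 mul1r addr0.
Qed.

(** The dilation of ratio e centred so as to map 0 to x. *)
Definition dilate (e : R) x (z : mR3 R) : mR3 R :=
  (x.1.1 + e * z.1.1, x.1.2 + e * z.1.2, x.2 + e * z.2).

Lemma measurable_affine_line (a b : R) :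
  measurable_fun setT (fun t : measurableTypeR R => b + a * t : measurableTypeR R).
Proof. by apply: measurable_funD => //; exact: measurable_funM. Qed.

Lemma rescales_dilate e x : 0 < e -> rescales (@leb3 R) (dilate e x) (e * e * e).
Proof.
move=> e0; have e1 := ltW e0.
have m2 : measurable_fun setT (fun p : measurableTypeR R * measurableTypeR R =>
    (x.1.1 + e * p.1, x.1.2 + e * p.2) : measurableTypeR R * measurableTypeR R).
  apply: measurable_fun_pair.
    exact: measurableT_comp (measurable_affine_line e x.1.1) measurable_fst.
  exact: measurableT_comp (measurable_affine_line e x.1.2) measurable_snd.
have r1 b := @rescales_lebesgue R e b e0.
have r2 := rescales_prod (measurable_affine_line e x.1.1)
  (measurable_affine_line e x.1.2) e1 e1 (r1 _) (r1 _).
exact: (@rescales_prod _ _ _ _ _ (@leb2 R) _ _ _ _ _ m2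
  (measurable_affine_line e x.2) (mulr_ge0 e1 e1) e1 r2 (r1 _)).
Qed.

Lemma measurable_dilate e x : measurable_fun setT (dilate e x).
Proof.
have [m1 m2 m3] := measurable_coords.
apply: measurable_fun_pair; first apply: measurable_fun_pair.
- exact: measurableT_comp (measurable_affine_line e x.1.1) m1.
- exact: measurableT_comp (measurable_affine_line e x.1.2) m2.
- exact: measurableT_comp (measurable_affine_line e x.2) m3.
Qed.

Lemma poisson3_dilate e x z : 0 < e ->
  poisson3 e (x - dilate e x z) = (e * e * e)^-1 * poisson3 1 z.
Proof.
move=> e0; have h a b : poisson e (a - (a + e * b)) = e^-1 * poisson 1 b.
  rewrite opprD addrA subrr add0r [LHS]poisson_scale// mulrN mulKf ?gt_eqF//.
  by rewrite /poisson sqrrN.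
by rewrite /poisson3/= !h !invfM; ring.
Qed.

Lemma measurable_poisson e : 0 < e -> measurable_fun setT (fun t : measurableTypeR R => poisson e t).
Proof.
move=> e0; have mp1 := continuous_measurable_fun (@continuous_poisson1 R).
rewrite (_ : (fun t => _) = fun t : measurableTypeR R => e^-1 * poisson 1 (e^-1 * t)); last first.
  by apply/funext => t; rewrite poisson_scale.
apply: measurable_funM => //; apply: (measurableT_comp mp1).
exact: measurable_funM.
Qed.

Lemma measurable_poisson3 d (T : measurableType d) (f : T -> mR3 R) e : 0 < e ->
  measurable_fun setT f -> measurable_fun setT (fun t => poisson3 e (f t)).
Proof.
move=> e0 mf; have [m1 m2 m3] := measurable_coords.
have mp := measurable_poisson e0.
apply: measurable_funM; first apply: measurable_funM.
- exact: measurableT_comp mp (measurableT_comp m1 mf).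
- exact: measurableT_comp mp (measurableT_comp m2 mf).
- exact: measurableT_comp mp (measurableT_comp m3 mf).
Qed.

Lemma poisson3_ge0 e x : 0 < e -> 0 <= poisson3 e x.
Proof. by move=> e0; apply: mulr_ge0; [apply: mulr_ge0|]; exact: poisson_ge0. Qed.

(** The constant relating the square of the Hartley transform to the identity;
    it equals (2 pi)^3, but only its positivity matters. *)
Definition hartley_cst : R := \int[@leb3 R]_z poisson3 1 z.

Lemma integrable_poisson3 : (@leb3 R).-integrable setT (EFin \o poisson3 1).
Proof.
have i1 := @integrable_poisson1 R.
have i2 := integrable_tensor i1 i1.
exact: (@integrable_tensor _ _ _ _ _ (@leb2 R) _ _ _ i2 i1).
Qed.

Lemma hartley_cst_gt0 : 0 < hartley_cst.
Proof.
have i1 := @integrable_poisson1 R.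
have i2 := integrable_tensor i1 i1.
have E1 : \int[@lebesgue_measure R]_t poisson 1 t = 2 * pi.
  rewrite /Rintegral ge0_symfun_integralT; first last.
  - by move=> t /=; rewrite /poisson sqrrN.
  - exact: continuous_poisson1.
  - by move=> t; exact: poisson_ge0.
  rewrite (_ : [set t | _] = `[0, +oo[%classic); last first.
    by apply/seteqP; split => t/=; rewrite in_itv/= andbT.
  have -> : (\int[@lebesgue_measure R]_(t in `[0%R, +oo[) (poisson 1 t)%:E =
      2%:E * \int[@lebesgue_measure R]_(t in `[0%R, +oo[) ((oneDsqr t)^-1)%R%:E)%E.
    rewrite -ge0_integralZl//.
    - by apply: eq_integral => t _; rewrite poisson1E.
    - apply/measurable_EFinP/measurable_funTS.
      exact: (continuous_measurable_fun (@continuous_oneDsqrV R)).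
  by rewrite integral0y_oneDsqr -!EFinM /=; field.
have p0 : 0 < 2 * pi :> R by rewrite mulr_gt0// pi_gt0.
rewrite /hartley_cst [ltRHS](@Rintegral_product _ _ _ _ _ (@leb2 R) lebesgue_measure _ integrable_poisson3); last first.
  move=> p; have := integrableZl measurableT (poisson 1 p.1 * poisson 1 p.2) i1.
  exact: eq_integrable.
rewrite (_ : \int[leb2]_p _ = \int[@leb2 R]_p ((2 * pi) * (poisson 1 p.1 * poisson 1 p.2))); last first.
  apply: eq_Rintegral => p _; rewrite /poisson3/= RintegralZl//.
  by rewrite E1 mulrC.
rewrite RintegralZl// pmulr_rgt0// [ltRHS](Rintegral_product i2); last first.
  move=> p; have := integrableZl measurableT (poisson 1 p) i1.
  exact: eq_integrable.
rewrite (_ : \int[lebesgue_measure]_p _ = \int[@lebesgue_measure R]_p ((2 * pi) * poisson 1 p)); last first.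
  apply: eq_Rintegral => p _; rewrite /= RintegralZl//.
  by rewrite E1 mulrC.
by rewrite RintegralZl// E1 mulr_gt0.
Qed.

Lemma integral_poisson3 e x : 0 < e ->
  (\int[@leb3 R]_y (poisson3 e (x - y))%:E = hartley_cst%:E)%E.
Proof.
move=> e0; have eee : 0 < e * e * e by rewrite !mulr_gt0.
rewrite (ge0_integral_rescale (measurable_dilate e x) (ltW eee) (rescales_dilate x e0)); last 2 first.
- apply/measurable_EFinP; apply: measurable_poisson3 => //.
  have [m1 m2 m3] := measurable_coords.
  by apply: measurable_fun_pair; first apply: measurable_fun_pair; apply: measurable_funB.
- by move=> y; rewrite lee_fin poisson3_ge0.
rewrite -ge0_integralZl//; last 3 first.
- apply/measurable_EFinP.
  rewrite (_ : (fun t => _) = fun t => (e * e * e)^-1 * poisson3 1 t); last first.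
    by apply/funext => t; rewrite poisson3_dilate.
  by apply: measurable_funM => //; exact: measurable_poisson3.
- by move=> y _; rewrite lee_fin poisson3_ge0.
- by rewrite lee_fin ltW.
rewrite /hartley_cst fineK; last first.
  by apply: integrable_fin_num => //; exact: integrable_poisson3.
apply: eq_integral => z _; rewrite poisson3_dilate// -EFinM.
by rewrite mulrA mulfV ?gt_eqF// mul1r.
Qed.

End poisson_kernel_space.

(** * The Hartley transform of square-integrable functions *)

Section hartley_transform.
Context {R : realType}.
Implicit Types (f v w : R3 R -> R) (x y q : R3 R).

(** The Hartley transform, defined by its integral; it is meaningful for
    integrable functions. *)
Definition hartley f : R3 R -> R := kernel_transform (@leb3 R) (@cas3 R) f.

(** The functions on which inversion is tested: continuous, bounded and
    integrable, so that their convolutions with the Poisson kernel converge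
    pointwise. *)
Definition admissible f := [/\ continuous f, measurable_fun (setT : set (mR3 R)) f,
  (@leb3 R).-integrable setT (EFin \o f) & exists M : R, forall x, `|f x| <= M].

(** The damping parameter, a sequence tending to 0. *)
Definition mesh n : R := n.+1%:R^-1.

Lemma mesh_gt0 n : 0 < mesh n.
Proof. by rewrite invr_gt0. Qed.

Lemma cvg_mesh : mesh n @[n --> \oo] --> (0 : R).
Proof. exact: cvg_harmonic. Qed.

Lemma cvg_damping3 q : damping3 (mesh n) q @[n --> \oo] --> (1 : R).
Proof.
have h (t : R) : damping (mesh n) t @[n --> \oo] --> (1 : R).
  have h : - mesh n * `|t| @[n --> \oo] --> - 0 * `|t|.
    by apply: cvgM; [apply: cvgN; exact: cvg_mesh|exact: cvg_cst].
  have -> : 1 = expR (- 0 * `|t|) by rewrite oppr0 mul0r expR0.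
  exact: (cvg_comp _ _ h (@continuous_expR R _)).
rewrite (_ : 1 = 1 * 1 * 1); last by rewrite !mulr1.
by apply: cvgM => //; apply: cvgM.
Qed.

Lemma cvg_dilate x z : (dilate (mesh n) x z : R3 R) @[n --> \oo] --> x.
Proof.
have h (a b : R) : a + mesh n * b @[n --> \oo] --> a.
  rewrite -[X in _ --> X]addr0 -[X in _ + X](mul0r b).
  by apply: cvgD; [exact: cvg_cst|apply: cvgM; [exact: cvg_mesh|exact: cvg_cst]].
case: x => [[a b] c].
exact: (cvg_pair (cvg_pair (h a z.1.1) (h b z.1.2)) (h c z.2)).
Qed.

Lemma integrable_poisson3_sub (e : R) x : 0 < e ->
  (@leb3 R).-integrable setT (EFin \o (fun y => poisson3 e (x - y))).
Proof.
move=> e0; apply/integrableP; split.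
  apply/measurable_EFinP; apply: measurable_poisson3 => //.
  have [m1 m2 m3] := @measurable_coords R.
  by apply: measurable_fun_pair; first apply: measurable_fun_pair; apply: measurable_funB.
rewrite (eq_integral (fun y : mR3 R => (poisson3 e (x - y))%:E)).
  by rewrite integral_poisson3// ltry.
by move=> y _; rewrite /= ger0_norm// poisson3_ge0.
Qed.

Lemma cvg_regularize f x : admissible f ->
  regularize (@leb3 R) (fun n z => poisson3 (mesh n) (z.1 - z.2)) n f x @[n --> \oo]
   --> hartley_cst * f x.
Proof.
move=> [cf mf jf [M fM]].
rewrite (_ : (fun n => _) = (fun n => \int[@leb3 R]_z (poisson3 1 z * f (dilate (mesh n) x z)))); last first.
  apply/funext => n; have e0 := mesh_gt0 n.
  have eee : 0 < mesh n * mesh n * mesh n by rewrite !mulr_gt0.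
  rewrite /regularize [LHS](Rintegral_rescale (measurable_dilate (mesh n) x) (ltW eee) (rescales_dilate x e0) eee); last first.
    have := integrable_bounded mf fM (integrable_poisson3_sub x e0).
    by apply: eq_integrable => // y _ /=; rewrite mulrC.
  rewrite -RintegralZl//; last first.
    apply: (@integrable_rescale _ _ _ _ _ _ (measurable_dilate (mesh n) x) (ltW eee)
      (rescales_dilate x e0) (fun y => poisson3 (mesh n) (x - y) * f y)) => //.
    have := integrable_bounded mf fM (integrable_poisson3_sub x e0).
    by apply: eq_integrable => // y _ /=; rewrite mulrC.
  apply: eq_Rintegral => z _; rewrite /= poisson3_dilate//.
  by rewrite -(mulrA _ (poisson3 1 z)) mulVKf// gt_eqF.
rewrite /hartley_cst -RintegralZr//; last exact: integrable_poisson3.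
have mp : measurable_fun setT (fun z : mR3 R => poisson3 1 z) by exact: measurable_poisson3.
apply: (proj2 (@Rdominated_cvg _ _ _ (@leb3 R) _ _ (fun z => M * poisson3 1 z) _ _ _ _ _)).
- move=> n; apply: measurable_funM => //.
  exact: measurableT_comp mf (measurable_dilate (mesh n) x).
- exact: measurable_funM.
- apply: aeW => z; apply: cvgM; first exact: cvg_cst.
  exact: (@cvg_comp _ _ _ (fun n => dilate (mesh n) x z : R3 R) f \oo (nbhs x) (nbhs (f x)) (cvg_dilate (x := x) z) (cf x)).
- have := integrableZl measurableT M (@integrable_poisson3 R).
  exact: eq_integrable.
- apply: aeW => z n; rewrite normrM mulrC (ger0_norm (poisson3_ge0 _ ltr01)).
  by rewrite ler_wpM2r// poisson3_ge0.
Qed.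

Let damping_ge0 n q : 0 <= damping3 (mesh n) q.
Proof. by rewrite !mulr_ge0// expR_ge0. Qed.

Let damping_le1 n q : damping3 (mesh n) q <= 1.
Proof.
have d1 t : damping (mesh n) t <= 1.
  by rewrite /damping expR_le1 mulNr oppr_le0 mulr_ge0// ltW// mesh_gt0.
by rewrite /damping3 !mulr_ile1 ?mulr_ge0 ?expR_ge0.
Qed.

Let measurable_poisson_sub n :
  measurable_fun setT (fun z : mR3 R * mR3 R => poisson3 (mesh n) (z.1 - z.2)).
Proof.
apply: measurable_poisson3; first exact: mesh_gt0.
have [m1 m2 m3] := @measurable_coords R.
by apply: measurable_fun_pair; first apply: measurable_fun_pair;
  apply: measurable_funB; (apply: (measurableT_comp m1)||apply: (measurableT_comp m2)||apply: (measurableT_comp m3)).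
Qed.

Let poisson_sub_ge0 n (z : mR3 R * mR3 R) : 0 <= poisson3 (mesh n) (z.1 - z.2).
Proof. exact: poisson3_ge0 (mesh_gt0 n). Qed.

Let integrable_damping_mesh n := integrable_damping3 (@mesh_gt0 n).

Let cas_damping n x y := Rintegral_cas3M_damping3 x y (mesh_gt0 n).

Let integral_poisson_mesh n x := integral_poisson3 x (mesh_gt0 n).

Lemma measurable_hartley f : measurable_fun (setT : set (mR3 R)) f ->
  measurable_fun (setT : set (mR3 R)) (hartley f).
Proof.
move=> mf.
exact: (@measurable_kernel_transform _ _ _ (@leb3 R) (@cas3 R) (@measurable_cas3 R) f mf).
Qed.

Lemma sq_norm_hartley f : (@leb3 R).-integrable setT (EFin \o f) ->
  (sq_norm (@leb3 R) (hartley f) <= hartley_cst%:E * sq_norm (@leb3 R) f)%E.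
Proof.
exact: (@sq_norm_kernel_transform _ _ _ (@leb3 R) (@cas3 R) 2 (@measurable_cas3 R)
  (@cas3_bounded R) (@cas3C R) (fun n => damping3 (mesh n))
  (fun n z => poisson3 (mesh n) (z.1 - z.2)) hartley_cst integrable_damping_mesh
  damping_ge0 cvg_damping3 measurable_poisson_sub poisson_sub_ge0
  (ltW hartley_cst_gt0) cas_damping integral_poisson_mesh).
Qed.

(** The Hartley transform of a square-integrable function, defined by duality
    with admissible functions, with its norm bound and inversion formula. *)
Theorem hartley_square_integrable v : measurable_fun (setT : set (mR3 R)) v ->
  (sq_norm (@leb3 R) v < +oo)%E ->
  exists w, [/\ measurable_fun (setT : set (mR3 R)) w,
    (sq_norm (@leb3 R) w <= hartley_cst%:E * sq_norm (@leb3 R) v)%E &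
    forall f, admissible f ->
      [/\ (@leb3 R).-integrable setT (EFin \o (fun x => w x * f x)),
          (@leb3 R).-integrable setT (EFin \o (fun x => w x * hartley f x)),
          \int[@leb3 R]_x (w x * f x) = \int[@leb3 R]_x (v x * hartley f x) &
          \int[@leb3 R]_x (w x * hartley f x) =
            hartley_cst * \int[@leb3 R]_x (v x * f x)]].
Proof.
move=> mv v2.
have [w [mw w2 wE]] := @kernel_transform_square_integrable _ _ _ (@leb3 R)
  (@cas3 R) 2 (@measurable_cas3 R) (@cas3_bounded R) (@cas3C R)
  (fun n => damping3 (mesh n)) (fun n z => poisson3 (mesh n) (z.1 - z.2)) hartley_cst
  integrable_damping_mesh damping_ge0 damping_le1 cvg_damping3 measurable_poisson_sub
  poisson_sub_ge0 (ltW hartley_cst_gt0) cas_damping integral_poisson_mesh v mv v2.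
exists w; split => // f af; have [cf mf jf [M fM]] := af.
apply: (wE f M jf fM) => x; exact: cvg_regularize.
Qed.

End hartley_transform.

(** * Schwartz functions and powers of 1 + |x|^2 *)

Section schwartz_functions.
Context {R : realType}.
Implicit Types (f g : R3 R -> R) (x y q : R3 R) (s : R) (i j : 'I_3) (l : seq 'I_3).

(** The i-th coordinate, as a linear form. *)
Definition coord_fun i x : R := coord3 x i.

Lemma coord_fun_is_linear i : linear (coord_fun i).
Proof.
rewrite /coord_fun.
move=> a x y; rewrite /coord3.
by case: i => [[|[|[|//]]]] /=.
Qed.

HB.instance Definition _ i :=
  GRing.isLinear.Build R (R3 R) R^o *:%R (coord_fun i) (coord_fun_is_linear i).

Lemma continuous_coord3 i : continuous (coord_fun i).
Proof.
move=> x; rewrite /coord_fun /coord3; case: i => [[|[|[|//]]]] _ /=.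
- exact: (cvg_comp _ _ (@cvg_fst _ _ _ _ _) (@cvg_fst _ _ _ _ _)).
- exact: (cvg_comp _ _ (@cvg_fst _ _ _ _ _) (@cvg_snd _ _ _ _ _)).
- exact: cvg_snd.
Qed.

Lemma differentiable_coord3 i x : differentiable (coord_fun i) x.
Proof.
apply: linear_differentiable; exact: continuous_coord3.
Qed.

Lemma derive_coord3 i x v : 'D_v (coord_fun i) x = coord3 v i.
Proof.
rewrite deriveE; last exact: differentiable_coord3.
by rewrite diff_lin//; exact: continuous_coord3.
Qed.

Lemma enorm_sqr x : enorm x ^+ 2 = dot x x.
Proof. by rewrite sqr_sqrtr// dotE !addr_ge0// -expr2 sqr_ge0. Qed.

Lemma enorm_ge0 x : 0 <= enorm x.
Proof. exact: sqrtr_ge0. Qed.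

Lemma coord3_le_enorm x i : `|coord3 x i| <= enorm x.
Proof.
rewrite -(@ler_pXn2r _ 2) ?nnegrE ?enorm_ge0// enorm_sqr real_normK ?num_real//.
rewrite dotE -!expr2 /coord3.
have := sqr_ge0 x.1.1; have := sqr_ge0 x.1.2; have := sqr_ge0 x.2.
by case: i => [[|[|[|//]]]] _ /= *; lra.
Qed.

Lemma coord3_basis3 i j : coord3 (basis3 i) j = (i == j)%:R :> R.
Proof.
rewrite /coord3 /basis3 /vec3 /=.
by case: j => [[|[|[|//]]]] hj /=; congr (nat_of_bool _)%:R; congr (_ == _); exact/val_inj.
Qed.

(** The polynomial 1 + |x|^2, written without the square root in the norm and
    so visibly smooth. *)
Definition weight x : R := 1 + dot x x.

Lemma japaneseE s x : japanese s x = weight x `^ (s / 2).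
Proof. by rewrite /japanese enorm_sqr. Qed.

Lemma weight_gt0 x : 0 < weight x.
Proof. by rewrite /weight -enorm_sqr ltr_wpDr ?sqr_ge0. Qed.

Lemma weightE : weight = cst 1 + \sum_(i < 3) ((coord_fun i) ^+ 2).
Proof.
apply/funext => x; rewrite /weight /dot !fctE fct_sumE; congr (_ + _).
Qed.

Lemma differentiable_weight x : differentiable weight x.
Proof.
rewrite weightE; apply: differentiableD; first exact: differentiable_cst.
by apply: differentiable_sum => i; apply: differentiableX; exact: differentiable_coord3.
Qed.

Lemma derive_weight i x : 'D_(basis3 i) weight x = 2 * coord3 x i.
Proof.
have dd j v : derivable (coord_fun j) x v by apply: diff_derivable; exact: differentiable_coord3.
rewrite weightE deriveD; last 2 first.
- exact: derivable_cst.
- by apply: derivable_sum => j; exact: derivableX.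
rewrite derive_cst add0r derive_sum; last by move=> j; exact: derivableX.
under eq_bigr => j _ do rewrite deriveX// derive_coord3 coord3_basis3.
rewrite (bigD1 i)//= eqxx big1 ?addr0; last first.
  by move=> j ji; rewrite eq_sym (negbTE ji) scaler0.
by rewrite /GRing.scale/= mulr1 expr1.
Qed.

Lemma differentiable_japanese s x : differentiable (japanese s) x.
Proof.
rewrite (_ : japanese s = (fun t => t `^ (s / 2)) \o weight); last first.
  by apply/funext => y; rewrite japaneseE.
apply: differentiable_comp; first exact: differentiable_weight.
by apply/derivable1_diffP; apply: derivable_powR; rewrite in_itv/= andbT weight_gt0.
Qed.

Lemma derive_japanese s i x :
  'D_(basis3 i) (japanese s) x = s * (coord3 x i * japanese (s - 2) x).
Proof.
have dp : derivable (fun t => t `^ (s / 2)) (weight x) 1.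
  by apply: derivable_powR; rewrite in_itv/= andbT weight_gt0.
rewrite deriveE; last exact: differentiable_japanese.
rewrite (_ : japanese s = (fun t => t `^ (s / 2)) \o weight); last first.
  by apply/funext => y; rewrite japaneseE.
rewrite diff_comp; [|exact: differentiable_weight|exact/derivable1_diffP].
rewrite /= deriv1E// -deriveE; last exact: differentiable_weight.
rewrite derive_weight powR_derive1 ?in_itv/= ?andbT ?weight_gt0//.
rewrite japaneseE (_ : (s - 2) / 2 = s / 2 - 1); last by field.
by rewrite /GRing.scale/=; field.
Qed.

(** The functions obtained from the derivatives of f by sums, scalings and
    multiplications by coordinates and by powers of 1 + |x|^2.  This class is
    stable under differentiation, because the derivative of
    (1 + |x|^2)^(s/2) is s x_i (1 + |x|^2)^((s-2)/2), and its members decay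
    rapidly when f does: all of them are Schwartz functions. *)
Inductive multiplier_closure f : (R3 R -> R) -> Prop :=
| closure_pderiv l : multiplier_closure f (pderiv l f)
| closure_coord i g : multiplier_closure f g ->
    multiplier_closure f (fun x => coord3 x i * g x)
| closure_japanese s g : multiplier_closure f g ->
    multiplier_closure f (fun x => japanese s x * g x)
| closure_scale (a : R) g : multiplier_closure f g ->
    multiplier_closure f (fun x => a * g x)
| closure_add g h : multiplier_closure f g -> multiplier_closure f h ->
    multiplier_closure f (fun x => g x + h x).

Lemma multiplier_closure_differentiable f g : schwartz f ->
  multiplier_closure f g -> forall x, differentiable g x.
Proof.
move=> [sf _]; elim => [l x|i h _ IH x|s h _ IH x|a h _ IH x|h k _ IH1 _ IH2 x].
- exact: sf.
- by apply: differentiableM => //; exact: differentiable_coord3.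
- by apply: differentiableM => //; exact: differentiable_japanese.
- by apply: differentiableM => //; exact: differentiable_cst.
- exact: differentiableD.
Qed.

Lemma multiplier_closure_derive f g i : schwartz f ->
  multiplier_closure f g -> multiplier_closure f (fun x => 'D_(basis3 i) g x).
Proof.
move=> sf; elim => [l|j h ch IH|s h ch IH|a h ch IH|h k ch IH1 ck IH2].
- exact: (closure_pderiv f (i :: l)).
- have -> : (fun x => 'D_(basis3 i) (fun y => coord3 y j * h y) x) =
      (fun x => coord3 x j * 'D_(basis3 i) h x + (i == j)%:R * h x).
    apply/funext => x.
    have dh := multiplier_closure_differentiable sf ch x.
    rewrite (@deriveM _ _ (coord_fun j) h); [|by apply: diff_derivable; exact: differentiable_coord3|exact: diff_derivable].
    by rewrite derive_coord3 coord3_basis3 /GRing.scale/= (mulrC (h x)).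
  by apply: closure_add; [exact: closure_coord|exact: closure_scale].
- have -> : (fun x => 'D_(basis3 i) (fun y => japanese s y * h y) x) =
      (fun x => japanese s x * 'D_(basis3 i) h x +
                s * (coord3 x i * (japanese (s - 2) x * h x))).
    apply/funext => x.
    have dh := multiplier_closure_differentiable sf ch x.
    rewrite (@deriveM _ _ (japanese s) h); [|by apply: diff_derivable; exact: differentiable_japanese|exact: diff_derivable].
    by rewrite derive_japanese /GRing.scale/=; ring.
  apply: closure_add; first exact: closure_japanese.
  by apply: closure_scale; apply: closure_coord; exact: closure_japanese.
- have -> : (fun x => 'D_(basis3 i) (fun y => a * h y) x) =
      (fun x => a * 'D_(basis3 i) h x).
    apply/funext => x.
    have dh := multiplier_closure_differentiable sf ch x.
    by rewrite (@deriveZ _ _ _ h a)//; exact: diff_derivable.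
  exact: closure_scale.
- have -> : (fun x => 'D_(basis3 i) (fun y => h y + k y) x) =
      (fun x => 'D_(basis3 i) h x + 'D_(basis3 i) k x).
    apply/funext => x.
    have dh := multiplier_closure_differentiable sf ch x.
    have dk := multiplier_closure_differentiable sf ck x.
    by rewrite (@deriveD _ _ _ h k)//; exact: diff_derivable.
  exact: closure_add.
Qed.

Lemma japanese_ge0 s x : 0 <= japanese s x.
Proof. exact: powR_ge0. Qed.

Lemma japanese_le s : exists m : nat, forall x, japanese s x <= (1 + enorm x) ^+ m.
Proof.
exists (Num.bound `|s|) => x; rewrite /japanese.
have e0 := enorm_ge0 x.
have h1 : 1 <= 1 + enorm x by rewrite lerDl.
have w1 : 1 <= 1 + enorm x ^+ 2 by rewrite lerDl sqr_ge0.
apply: (@le_trans _ _ ((1 + enorm x ^+ 2) `^ ((Num.bound `|s|)%:R / 2))).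
  by apply: ler_powR => //; rewrite ler_pM2r ?invr_gt0// (le_trans (ler_norm _))// ltW// archi_boundP.
apply: (@le_trans _ _ (((1 + enorm x) ^+ 2) `^ ((Num.bound `|s|)%:R / 2))).
  rewrite ge0_ler_powR ?nnegrE//; [exact: le_trans ler01 w1|exact: sqr_ge0|nra].
rewrite -powR_mulrn ?(le_trans ler01 h1)// -powRrM.
by rewrite mulrCA mulfV// mulr1 powR_mulrn// (le_trans ler01 h1).
Qed.

Lemma multiplier_closure_decay f g : schwartz f -> multiplier_closure f g ->
  forall k, exists C : R, forall x, (1 + enorm x) ^+ k * `|g x| <= C.
Proof.
move=> [_ df]; have p0 x k : 0 <= (1 + enorm x) ^+ k.
  by rewrite exprn_ge0// addr_ge0// enorm_ge0.
elim => [l k|i h _ IH k|s h _ IH k|a h _ IH k|h h' _ IH1 _ IH2 k].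
- exact: df.
- have [C HC] := IH k.+1; exists C => x; apply: le_trans (HC x).
  rewrite normrM mulrA ler_wpM2r// exprSr ler_wpM2l//.
  by apply: le_trans (coord3_le_enorm x i) _; rewrite lerDr.
- have [m Hm] := japanese_le s.
  have [C HC] := IH (k + m)%N; exists C => x; apply: le_trans (HC x).
  rewrite normrM mulrA ler_wpM2r// exprD ler_wpM2l//.
  by rewrite ger0_norm ?japanese_ge0.
- have [C HC] := IH k; exists (`|a| * C) => x.
  by rewrite normrM mulrCA ler_wpM2l.
- have [C HC] := IH1 k; have [C' HC'] := IH2 k; exists (C + C') => x.
  apply: le_trans (lerD (HC x) (HC' x)); rewrite -mulrDr ler_wpM2l//.
  exact: ler_normD.
Qed.

Lemma multiplier_closure_schwartz f g : schwartz f -> multiplier_closure f g ->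
  schwartz g.
Proof.
move=> sf cg.
have cl l : multiplier_closure f (pderiv l g).
  by elim: l => [//|i l IH]; exact: multiplier_closure_derive.
split=> [l x|l k]; first exact: multiplier_closure_differentiable (cl l) x.
exact: multiplier_closure_decay (cl l) k.
Qed.

Lemma schwartz_japanese s f : schwartz f -> schwartz (fun x => japanese s x * f x).
Proof.
move=> sf; apply: (multiplier_closure_schwartz sf).
by apply: closure_japanese; exact: (closure_pderiv f [::]).
Qed.

End schwartz_functions.

(** * Continuous functions on space are measurable *)

Section continuous_measurable.
Context {R : realType}.

(** The largest multiple of 1/(n+1) that is at most t. *)
Definition grid (n : nat) (t : R) : R := (Num.floor (n.+1%:R * t))%:~R / n.+1%:R.

Lemma cvg_grid (t : R) : grid n t @[n --> \oo] --> t.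
Proof.
have c1 : t - mesh n @[n --> \oo] --> t.
  have -> : nbhs t = nbhs (t - 0) by rewrite subr0.
  by apply: cvgB; [exact: cvg_cst|exact: cvg_mesh].
apply: (@squeeze_cvgr _ _ _ _ (fun n => t - mesh n) (fun=> t)) => //; last exact: cvg_cst.
apply: nearW => n.
have n0 : 0 < n.+1%:R :> R by [].
rewrite /grid /mesh ler_pdivlMr// ler_pdivrMr// (mulrC t) floor_le andbT.
rewrite mulrBl mulVf ?gt_eqF// lerBlDr (mulrC t) ltW//.
by have := floorD1_gt (n.+1%:R * t); rewrite intrD.
Qed.

Lemma cvg_grid3 (x : R3 R) :
  ((grid n x.1.1, grid n x.1.2, grid n x.2) : R3 R) @[n --> \oo] --> x.
Proof.
case: x => [[a b] c].
exact: (cvg_pair (cvg_pair (@cvg_grid a) (@cvg_grid b)) (@cvg_grid c)).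
Qed.

Lemma measurable_countable_fibers d d' (T : measurableType d) (U : measurableType d')
    (I : countType) (h : T -> I) (g : I -> U) :
  (forall i, measurable (h @^-1` [set i])) -> measurable_fun setT (g \o h).
Proof.
move=> mh _ B mB; rewrite setTI.
rewrite (_ : _ @^-1` _ = \bigcup_i ([set x | B (g i)] `&` (h @^-1` [set i]))).
  apply: countable_bigcupT_measurable => [|i]; first exact: countableP.
  have [Bi|nBi] := pselect (B (g i)).
    by rewrite (_ : [set x | _] = setT) ?setTI//; apply/seteqP; split.
  by rewrite (_ : [set x | _] = set0) ?set0I//; apply/seteqP; split.
apply/seteqP; split => [x Bx|x [i _ [Bi /= hi]]]; first by exists (h x).
by rewrite /= hi.
Qed.

Lemma measurable_floor_fiber n (i : int) :
  measurable ((fun t : measurableTypeR R => Num.floor (n.+1%:R * t)) @^-1` [set i]).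
Proof.
rewrite (_ : _ @^-1` _ = `[i%:~R / n.+1%:R, (i + 1)%:~R / n.+1%:R[%classic)//.
apply/seteqP; split => t /=; rewrite in_itv/= ler_pdivrMr// ltr_pdivlMr// (mulrC t).
  by move=> <-; rewrite floor_le floorD1_gt.
by move=> h; apply: floor_def.
Qed.

(** A continuous function is measurable for the product of the Borel sets of the
    line: it is the limit of its values at the grid points below the variable,
    which are constant on each box of a countable grid. *)
Lemma continuous_measurable_fun3 (f : R3 R -> R) : continuous f ->
  measurable_fun (setT : set (mR3 R)) f.
Proof.
move=> cf.
pose fl n (t : measurableTypeR R) : int := Num.floor (n.+1%:R * t).
pose h n (x : mR3 R) := (fl n x.1.1, fl n x.1.2, fl n x.2).
pose g n (i : int * int * int) : R :=
  f (i.1.1%:~R / n.+1%:R, i.1.2%:~R / n.+1%:R, i.2%:~R / n.+1%:R).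
apply: (@measurable_fun_cvg _ _ _ _ (fun n => g n \o h n)).
- move=> n; apply: measurable_countable_fibers => -[[i j] k].
  have [m1 m2 m3] := @measurable_coords R.
  rewrite (_ : _ @^-1` _ = ((fun x : mR3 R => x.1.1) @^-1` (fl n @^-1` [set i])) `&`
   ((fun x : mR3 R => x.1.2) @^-1` (fl n @^-1` [set j])) `&`
   ((fun x : mR3 R => x.2) @^-1` (fl n @^-1` [set k]))).
    apply: measurableI; first apply: measurableI; rewrite -[X in measurable X]setTI.
    - by apply: m1 => //; exact: measurable_floor_fiber.
    - by apply: m2 => //; exact: measurable_floor_fiber.
    - by apply: m3 => //; exact: measurable_floor_fiber.
  apply/seteqP; split => x /=; first by rewrite /h => -[<- <- <-].
  by rewrite /h => -[[-> ->] ->].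
- move=> x _.
  exact: (@cvg_comp _ _ _ (fun n => (grid n x.1.1, grid n x.1.2, grid n x.2) : R3 R)
    f \oo (nbhs (x : R3 R)) (nbhs (f x)) (@cvg_grid3 x) (cf x)).
Qed.

Lemma schwartz_continuous (f : R3 R -> R) : schwartz f -> continuous f.
Proof. by move=> [sf _] x; apply: differentiable_continuous; exact: (sf [::] x). Qed.

(** The Poisson kernel, known to be integrable, decays no faster than
    |x|^-6; it thus dominates any Schwartz function. *)
Lemma poisson3_decay (x : R3 R) : 8 <= (1 + enorm x) ^+ 6 * poisson3 1 x.
Proof.
have e0 := enorm_ge0 x.
have h (t : R) : `|t| <= enorm x -> 2 <= (1 + enorm x) ^+ 2 * poisson 1 t.
  move=> tx; rewrite poisson1E mulrCA ler_peMr// /oneDsqr ler_pdivlMr ?mul1r.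
    by rewrite -(real_normK (num_real t)); have := normr_ge0 t; nra.
  by rewrite ltr_wpDr// sqr_ge0.
have h1 := h _ (coord3_le_enorm x 0).
have h2 := h _ (coord3_le_enorm x 1).
have h3 := h _ (coord3_le_enorm x 2).
rewrite (_ : (1 + enorm x) ^+ 6 * poisson3 1 x =
  ((1 + enorm x) ^+ 2 * poisson 1 x.1.1) * ((1 + enorm x) ^+ 2 * poisson 1 x.1.2) *
  ((1 + enorm x) ^+ 2 * poisson 1 x.2)); last by rewrite /poisson3; ring.
rewrite (_ : 8 = 2 * 2 * 2); last by rewrite -!natrM.
by rewrite ler_pM// ?mulr_ge0// ler_pM.
Qed.

Lemma schwartz_admissible (f : R3 R -> R) : schwartz f -> admissible f.
Proof.
move=> sf; have cf := schwartz_continuous sf.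
have mf := continuous_measurable_fun3 cf.
have [_ df] := sf; split => //.
- have [C HC] := df [::] 6%N.
  apply: (@integrable_le _ _ _ _ _ (fun x : mR3 R => (C / 8) * poisson3 1 x)) => //.
    move=> x; have := HC x; rewrite /= => HCx.
    have p8 := poisson3_decay x.
    have p1 : 0 < (1 + enorm x) ^+ 6.
      by rewrite exprn_gt0// ltr_pwDl// enorm_ge0.
    have p2 := poisson3_ge0 x ltr01.
    rewrite -(ler_pM2l p1); apply: (le_trans HCx).
    have C0 : 0 <= C by apply: le_trans HCx; rewrite mulr_ge0// ltW.
    rewrite mulrCA {1}(_ : C = C / 8 * 8); last by field.
    by rewrite ler_wpM2l// divr_ge0.
  have := integrableZl measurableT (C / 8) (@integrable_poisson3 R).
  exact: eq_integrable.
- have [C HC] := df [::] 0%N; exists C => x.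
  by have := HC x; rewrite expr0 mul1r.
Qed.

End continuous_measurable.

(** * The Fourier transform of square-integrable functions *)

Section fourier_square_integrable.
Context {R : realType}.
Local Notation mu := (@leb3 R).
Implicit Types (f g v w : R3 R -> R) (x q : R3 R).

Lemma sq_norm_ge0 d (T : measurableType d) (m : {measure set T -> \bar R}) (f : T -> R) :
  (0 <= sq_norm m f)%E.
Proof. by apply: integral_ge0 => x _; exact: sqr_EFin_ge0. Qed.

Lemma measurable_opp3 : measurable_fun (setT : set (mR3 R)) (fun x : mR3 R => - (x : R3 R) : mR3 R).
Proof.
have [m1 m2 m3] := @measurable_coords R.
have mo : measurable_fun setT (fun t : measurableTypeR R => - t : measurableTypeR R).
  by apply: continuous_measurable_fun => t; exact: opp_continuous.
apply: measurable_fun_pair; first apply: measurable_fun_pair.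
- exact: measurableT_comp mo m1.
- exact: measurableT_comp mo m2.
- exact: measurableT_comp mo m3.
Qed.

Lemma rescales_opp3 : rescales mu (fun x : mR3 R => - (x : R3 R) : mR3 R) 1.
Proof.
have mo : measurable_fun setT (fun t : measurableTypeR R => - t : measurableTypeR R).
  by apply: continuous_measurable_fun => t; exact: opp_continuous.
have m2 : measurable_fun setT (fun p : measurableTypeR R * measurableTypeR R =>
    (- p.1, - p.2) : measurableTypeR R * measurableTypeR R).
  apply: measurable_fun_pair.
    exact: measurableT_comp mo measurable_fst.
  exact: measurableT_comp mo measurable_snd.
have r1 := @rescales_lebesgue_opp R.
have r2 := rescales_prod mo mo ler01 ler01 r1 r1.
have := @rescales_prod _ _ _ _ _ (@leb2 R) _ _ _ _ _ m2 mo (mulr_ge0 ler01 ler01) ler01 r2 r1.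
by rewrite !mulr1.
Qed.

Lemma integrable_opp3 f : mu.-integrable setT (EFin \o f) ->
  mu.-integrable setT (EFin \o (fun x => f (- x))).
Proof. exact: (@integrable_rescale _ _ _ mu _ _ measurable_opp3 ler01 rescales_opp3 f ltr01). Qed.

Lemma Rintegral_opp3 f : mu.-integrable setT (EFin \o f) ->
  \int[mu]_x f (- x) = \int[mu]_x f x.
Proof.
move=> jf.
by rewrite [RHS](@Rintegral_rescale _ _ _ mu _ _ measurable_opp3 ler01 rescales_opp3 f ltr01 jf) mul1r.
Qed.

Lemma sq_norm_opp3 f : measurable_fun (setT : set (mR3 R)) f ->
  sq_norm mu (fun x => f (- x)) = sq_norm mu f.
Proof.
move=> mf; rewrite /sq_norm [RHS](@ge0_integral_rescale _ _ _ mu _ _ measurable_opp3 ler01 rescales_opp3)//.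
- by rewrite mul1e.
- exact: measurable_sqr.
- by move=> x; exact: sqr_EFin_ge0.
Qed.

(** Even and odd parts, both of the shape f(x)/2 + a f(-x); the lemmas on halves
    below treat them at once. *)
Definition even_part f x := 2^-1 * f x + 2^-1 * f (- x).
Definition odd_part f x := 2^-1 * f x + (- 2^-1) * f (- x).

Lemma measurable_comp_opp3 f : measurable_fun (setT : set (mR3 R)) f ->
  measurable_fun (setT : set (mR3 R)) (fun x => f (- x)).
Proof. by move=> mf; exact: (measurableT_comp mf measurable_opp3). Qed.

Lemma measurable_halves (a : R) f : measurable_fun (setT : set (mR3 R)) f ->
  measurable_fun (setT : set (mR3 R)) (fun x => 2^-1 * f x + a * f (- x)).
Proof.
move=> mf; apply: measurable_funD; apply: measurable_funM => //.
exact: measurable_comp_opp3.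
Qed.

Lemma sq_norm_halves (a : R) f : a ^+ 2 = 2^-1 ^+ 2 ->
  measurable_fun (setT : set (mR3 R)) f ->
  (sq_norm mu (fun x => 2^-1 * f x + a * f (- x))%R <= sq_norm mu f)%E.
Proof.
move=> a2 mf; have mof := measurable_comp_opp3 mf.
apply: le_trans (sq_normD mu (@ltr01 R) _ _) _; [exact: measurable_funM..|].
rewrite !sq_normZ// sq_norm_opp3// a2 invr1 !muleA -EFinM.
rewrite -ge0_muleDl ?lee_fin//; [|lra..].
by rewrite -EFinD (_ : (1 + 1) * 2^-1 ^+ 2 + (1 + 1) * 2^-1 ^+ 2 = 1) ?mul1e//; field.
Qed.

Lemma admissible_halves (a : R) f : admissible f ->
  admissible (fun x => 2^-1 * f x + a * f (- x)).
Proof.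
move=> [cf mf jf [M fM]]; split.
- move=> x; apply: cvgD; (apply: cvgM; first exact: cvg_cst); first exact: cf.
  apply: (@cvg_comp _ _ _ (fun y : R3 R => - y) f (nbhs x) (nbhs (- x)) (nbhs (f (- x)))); last exact: cf.
  exact: opp_continuous.
- exact: measurable_halves.
- have := integrableD measurableT (integrableZl measurableT 2^-1 jf)
    (integrableZl measurableT a (integrable_opp3 jf)).
  exact: eq_integrable.
- exists (2^-1 * M + `|a| * M) => x; apply: le_trans (ler_normD _ _) _.
  by rewrite !normrM (ger0_norm (_ : 0 <= 2^-1)) ?invr_ge0// lerD// ler_wpM2l.
Qed.

(** Taking a half of the test function amounts to taking the same half of the
    function it is paired with. *)
Lemma Rintegral_halves (a : R) w f :
  mu.-integrable setT (EFin \o (fun x => w x * f x)) ->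
  mu.-integrable setT (EFin \o (fun x => w x * f (- x))) ->
  mu.-integrable setT (EFin \o (fun x => (2^-1 * w x + a * w (- x)) * f x)) /\
  \int[mu]_x (w x * (2^-1 * f x + a * f (- x))) =
  \int[mu]_x ((2^-1 * w x + a * w (- x)) * f x).
Proof.
move=> i1 i2; have i3 := integrable_opp3 i2.
have i3' : mu.-integrable setT (EFin \o (fun x => w (- x) * f x)).
  by apply: eq_integrable i3 => // x _ /=; rewrite opprK.
have ir : mu.-integrable setT (EFin \o (fun x => (2^-1 * w x + a * w (- x)) * f x)).
  have := integrableD measurableT (integrableZl measurableT 2^-1 i1)
    (integrableZl measurableT a i3').
  by apply: eq_integrable => // x _ /=; rewrite -!EFinM -EFinD; congr EFin; ring.
split=> //.
transitivity (2^-1 * \int[mu]_x (w x * f x) + a * \int[mu]_x (w x * f (- x))).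
  rewrite -!RintegralZl// -RintegralD//.
  - by apply: eq_Rintegral => x _; ring.
  - exact: (integrableZl measurableT 2^-1 i1).
  - exact: (integrableZl measurableT a i2).
rewrite -(Rintegral_opp3 i2).
rewrite (_ : \int[mu]_x (w (- x) * f (- - x)) = \int[mu]_x (w (- x) * f x)); last first.
  by apply: eq_Rintegral => x _; rewrite opprK.
rewrite -!RintegralZl// -RintegralD//.
- by apply: eq_Rintegral => x _; ring.
- exact: (integrableZl measurableT 2^-1 i1).
- exact: (integrableZl measurableT a i3').
Qed.

Lemma dotN q x : dot q (- x) = - dot q x.
Proof. by rewrite !dotE/=; ring. Qed.

Lemma integrable_cas3 f q : mu.-integrable setT (EFin \o f) ->
  mu.-integrable setT (EFin \o (fun x => cas3 (q, x) * f x)).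
Proof. by move=> jf; apply: (integrable_kernel (@measurable_cas3 R) (@cas3_bounded R)). Qed.

Lemma hartley_halves (a : R) f q : mu.-integrable setT (EFin \o f) ->
  hartley (fun x => 2^-1 * f x + a * f (- x)) q =
  \int[mu]_x ((2^-1 * cas3 (q, x) + a * cas3 (q, - x)) * f x).
Proof.
move=> jf; rewrite /hartley /kernel_transform.
apply: (proj2 (@Rintegral_halves a (fun x => cas3 (q, x)) f _ _)).
- exact: integrable_cas3.
- exact: (@integrable_cas3 (fun x => f (- x)) q (integrable_opp3 jf)).
Qed.

Lemma Re_fourierE f q :
  complex.Re (fourier f q) = \int[mu]_x (cos (dot q x) * f x).
Proof.
rewrite leb3E; transitivity (\int[@lebesgue3 R]_x (cos (dot q x) * f x - sin (dot q x) * 0)).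
  by [].
by apply: eq_Rintegral => x _; rewrite mulr0 subr0.
Qed.

Lemma Im_fourierE f q :
  complex.Im (fourier f q) = \int[mu]_x (sin (dot q x) * f x).
Proof.
rewrite leb3E; transitivity (\int[@lebesgue3 R]_x (cos (dot q x) * 0 + sin (dot q x) * f x)).
  by [].
by apply: eq_Rintegral => x _; rewrite mulr0 add0r.
Qed.

Lemma Re_fourier f q : mu.-integrable setT (EFin \o f) ->
  complex.Re (fourier f q) = hartley (even_part f) q.
Proof.
move=> jf; rewrite Re_fourierE (hartley_halves 2^-1 q jf).
by apply: eq_Rintegral => x _; rewrite /cas3/= dotN cosN sinN; field.
Qed.

Lemma Im_fourier f q : mu.-integrable setT (EFin \o f) ->
  complex.Im (fourier f q) = hartley (odd_part f) q.
Proof.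
move=> jf; rewrite Im_fourierE (hartley_halves (- 2^-1) q jf).
by apply: eq_Rintegral => x _; rewrite /cas3/= dotN cosN sinN; field.
Qed.

(** The Fourier transform of a square-integrable g is the function with real
    part [even_part w] and imaginary part [odd_part w], where w is the Hartley
    transform of g. *)
Theorem fourier_of_square_integrable g : measurable_fun (setT : set (mR3 R)) g ->
  (sq_norm mu g < +oo)%E ->
  exists w, [/\ measurable_fun (setT : set (mR3 R)) w,
    (sq_norm mu w <= hartley_cst%:E * sq_norm mu g)%E &
    forall f, schwartz f ->
      \int[mu]_q (g q * complex.Re (fourier f q)) = \int[mu]_q (even_part w q * f q) /\
      \int[mu]_q (g q * complex.Im (fourier f q)) = \int[mu]_q (odd_part w q * f q)].
Proof.
move=> mg g2; have [w [mw w2 wE]] := hartley_square_integrable mg g2.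
exists w; split => // f /schwartz_admissible af.
have [_ _ jf _] := af.
have i1 : mu.-integrable setT (EFin \o (fun x => w x * f x)) by have [] := wE _ af.
have i2 : mu.-integrable setT (EFin \o (fun x => w x * f (- x))).
  have := integrableB measurableT (integrableZl measurableT 2 (let: And4 i _ _ _ := wE _ (admissible_halves 2^-1 af) in i)) i1.
  by apply: eq_integrable => // x _ /=; rewrite -!EFinM -EFinB; congr EFin; field.
have [_ _ E1 _] := wE _ (admissible_halves 2^-1 af).
have [_ _ E2 _] := wE _ (admissible_halves (- 2^-1) af).
split.
- rewrite -(proj2 (Rintegral_halves 2^-1 i1 i2)) E1.
  by apply: eq_Rintegral => q _; rewrite Re_fourier.
- rewrite -(proj2 (Rintegral_halves (- 2^-1) i1 i2)) E2.
  by apply: eq_Rintegral => q _; rewrite Im_fourier.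
Qed.

(** Conversely, a function with even real part and odd imaginary part is the
    Fourier transform of a real one, by the inversion formula applied to the
    Hartley transform of v1 + v2. *)
Theorem square_integrable_with_fourier v1 v2 :
  measurable_fun (setT : set (mR3 R)) v1 -> measurable_fun (setT : set (mR3 R)) v2 ->
  (sq_norm mu v1 < +oo)%E -> (sq_norm mu v2 < +oo)%E ->
  (forall q, v1 (- q) = v1 q) -> (forall q, v2 (- q) = - v2 q) ->
  exists u, [/\ measurable_fun (setT : set (mR3 R)) u,
    (sq_norm mu u <= (2 / hartley_cst)%:E * (sq_norm mu v1 + sq_norm mu v2))%E &
    forall f, schwartz f ->
      \int[mu]_q (u q * complex.Re (fourier f q)) = \int[mu]_q (v1 q * f q) /\
      \int[mu]_q (u q * complex.Im (fourier f q)) = \int[mu]_q (v2 q * f q)].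
Proof.
move=> mv1 mv2 v12 v22 ev1 ov2.
have c0 := @hartley_cst_gt0 R.
pose v q := v1 q + v2 q.
have mv : measurable_fun (setT : set (mR3 R)) v by exact: measurable_funD.
have vle : (sq_norm mu v <= 2%:E * (sq_norm mu v1 + sq_norm mu v2))%E.
  apply: le_trans (sq_normD mu (@ltr01 R) mv1 mv2) _.
  by rewrite invr1 -[1 + 1]/2 (ge0_muleDr _ (sq_norm_ge0 mu v1) (sq_norm_ge0 mu v2)).
have vfin : (sq_norm mu v < +oo)%E.
  apply: le_lt_trans vle _; rewrite lte_mul_pinfty//.
  by rewrite lte_add_pinfty.
have [w [mw w2 wE]] := hartley_square_integrable mv vfin.
exists (fun q => hartley_cst^-1 * w q); split.
- exact: measurable_funM.
- rewrite sq_normZ//; apply: (le_trans (lee_wpmul2l _ w2)); first by rewrite lee_fin sqr_ge0.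
  rewrite muleA -EFinM (_ : _ * hartley_cst = hartley_cst^-1); last first.
    by field; rewrite gt_eqF.
  apply: (le_trans (lee_wpmul2l _ vle)); first by rewrite lee_fin invr_ge0 ltW.
  by rewrite muleA -EFinM mulrC.
- move=> f /schwartz_admissible af; have [_ mf jf [M fM]] := af.
  have f2 : (sq_norm mu f < +oo)%E.
    apply: integrable_lty => //; have := integrable_bounded mf fM jf.
    exact: eq_integrable.
  have i1 : mu.-integrable setT (EFin \o (fun x => v x * f x)).
    exact: integrable_sq_prod.
  have i2 : mu.-integrable setT (EFin \o (fun x => v x * f (- x))).
    apply: integrable_sq_prod => //; first exact: measurable_comp_opp3.
    by rewrite sq_norm_opp3.
  have main (a : R) : \int[mu]_q (hartley_cst^-1 * w q * hartley (fun x => 2^-1 * f x + a * f (- x)) q) =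
      \int[mu]_q ((2^-1 * v q + a * v (- q)) * f q).
    have [_ iw _ E] := wE _ (admissible_halves a af).
    rewrite -(proj2 (Rintegral_halves a i1 i2)).
    under eq_Rintegral do rewrite -mulrA.
    by rewrite RintegralZl// E mulKf// gt_eqF.
  split.
  - transitivity (\int[mu]_q (hartley_cst^-1 * w q * hartley (even_part f) q)).
      by apply: eq_Rintegral => q _; rewrite Re_fourier.
    rewrite main; apply: eq_Rintegral => q _.
    by rewrite /v ev1 ov2; field.
  - transitivity (\int[mu]_q (hartley_cst^-1 * w q * hartley (odd_part f) q)).
      by apply: eq_Rintegral => q _; rewrite Im_fourier.
    rewrite main; apply: eq_Rintegral => q _.
    by rewrite /v ev1 ov2; field.
Qed.

End fourier_square_integrable.

(** * The Fourier transform of a signed measure *)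

Section charge_fourier_transform.
Context {R : realType}.
Variable rho : {charge set (mR3 R) -> \bar R}.

Lemma measurable_charge_integral (F : mR3 R * mR3 R -> R) :
  measurable_fun setT F ->
  measurable_fun setT (fun q => charge_integral rho (fun x => F (q, x))).
Proof.
move=> mF; rewrite /charge_integral; set hd := projT2 _.
by apply: measurable_funB; exact: measurable_parametric_Rintegral.
Qed.

Lemma charge_integralN (f : mR3 R -> R) : measurable_fun setT f ->
  (forall x, `|f x| <= 1) ->
  charge_integral rho (fun x => - f x) = - charge_integral rho f.
Proof.
move=> mf f1; rewrite /charge_integral; set hd := projT2 _.
have RN (m : {finite_measure set (mR3 R) -> \bar R}) :
    \int[m]_x (- f x) = - \int[m]_x f x.
  have jf : m.-integrable setT (EFin \o f).
    apply: measurable_bounded_integrable => //.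
      by rewrite ltey_eq fin_num_measure.
    exists 1; split => // r r1 x _; exact: le_trans (f1 x) (ltW r1).
  rewrite -[RHS]mulN1r -RintegralZl//.
  by apply: eq_Rintegral => x _; rewrite mulN1r.
by rewrite !RN; ring.
Qed.

(** The real and imaginary parts of the Fourier transform of rho. *)
Definition charge_cos q := charge_integral rho (fun x => cos (dot q x)).
Definition charge_sin q := charge_integral rho (fun x => sin (dot q x)).

Lemma measurable_charge_cos : measurable_fun (setT : set (mR3 R)) charge_cos.
Proof.
apply: (@measurable_charge_integral (fun z => cos (dot z.1 z.2))).
by apply: measurable_cos_comp; exact: measurable_dot.
Qed.

Lemma measurable_charge_sin : measurable_fun (setT : set (mR3 R)) charge_sin.
Proof.
apply: (@measurable_charge_integral (fun z => sin (dot z.1 z.2))).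
by apply: measurable_sin_comp; exact: measurable_dot.
Qed.

Lemma charge_cosN q : charge_cos (- q) = charge_cos q.
Proof.
congr (charge_integral rho _); apply/funext => x.
by rewrite dotC dotN cosN dotC.
Qed.

Lemma charge_sinN q : charge_sin (- q) = - charge_sin q.
Proof.
rewrite -charge_integralN.
- congr (charge_integral rho _); apply/funext => x.
  by rewrite dotC dotN sinN dotC.
- by apply: measurable_sin_comp; exact: measurable_dot.
- by move=> x; exact: norm_sin_le1.
Qed.

End charge_fourier_transform.

(** * The Biot-Savart multiplier *)

Section biot_savart_multiplier.
Context {R : realType}.
Local Notation C := R[i].
Local Notation mu := (@leb3 R).
Implicit Types (q : R3 R) (a b : 'I_3 -> R3 R -> R).
Variable rho : {charge set (mR3 R) -> \bar R}.
Local Notation A := (charge_cos rho).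
Local Notation B := (charge_sin rho).

(** The vector q / |q|^2, with value 0 at q = 0. *)
Definition coulomb (k : 'I_3) q : R := coord3 q k / enorm q ^+ 2.

(** The real and imaginary parts of the Biot-Savart multiplier applied to a
    vector a + i b, see [biot_savart_symbolE]. *)
Definition symbol_re a b (j : 'I_3) q : R :=
  - (A q * cross (coulomb ^~ q) (b ^~ q) j + B q * cross (coulomb ^~ q) (a ^~ q) j).
Definition symbol_im a b (j : 'I_3) q : R :=
  A q * cross (coulomb ^~ q) (a ^~ q) j - B q * cross (coulomb ^~ q) (b ^~ q) j.

Lemma biot_savart_symbolE a b (j : 'I_3) q :
  biot_savart_symbol rho (fun k q => (a k q +i* b k q)%C) j q =
  (symbol_re a b j q +i* symbol_im a b j q)%C.
Proof.
rewrite /biot_savart_symbol /symbol_re /symbol_im /cross -/(coulomb _ _).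
rewrite /charge_fourier -/(A q) -/(B q); simpc.
by congr (_ +i* _)%C; rewrite /coulomb; ring.
Qed.

Lemma enorm_sqE q : enorm q ^+ 2 = \sum_(k < 3) coord3 q k ^+ 2.
Proof. by rewrite enorm_sqr /dot; apply: eq_bigr => k _; rewrite expr2. Qed.

Lemma sum_coulomb_sq q : \sum_(k < 3) coulomb k q ^+ 2 = (enorm q)^-1 ^+ 2.
Proof.
under eq_bigr do rewrite /coulomb exprMn.
rewrite -mulr_suml -enorm_sqE; have [->|q0] := eqVneq (enorm q) 0.
  by rewrite expr0n/= !mul0r invr0 expr0n.
by field.
Qed.

(** One component of Lagrange's inequality for the vector product. *)
Lemma cross_sq_le (x y : 'I_3 -> R) j :
  cross x y j ^+ 2 <= (\sum_(k < 3) x k ^+ 2) * (\sum_(k < 3) y k ^+ 2).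
Proof.
have nj : j + 1 != j + 2%:R by case: j => [[|[|[|//]]]].
have two (z : 'I_3 -> R) : z (j + 1) ^+ 2 + z (j + 2%:R) ^+ 2 <= \sum_(k < 3) z k ^+ 2.
  rewrite (bigD1 (j + 1))//= (bigD1 (j + 2%:R)) 1?eq_sym//= lerD2l lerDl.
  by apply: sumr_ge0 => k _; exact: sqr_ge0.
apply: (@le_trans _ _ ((x (j + 1) ^+ 2 + x (j + 2%:R) ^+ 2) * (y (j + 1) ^+ 2 + y (j + 2%:R) ^+ 2))).
  rewrite -subr_ge0 /cross.
  rewrite (_ : _ - _ = (x (j + 1) * y (j + 1) + x (j + 2%:R) * y (j + 2%:R)) ^+ 2); last by ring.
  exact: sqr_ge0.
by apply: ler_pM => //; rewrite addr_ge0// sqr_ge0.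
Qed.

Lemma symbol_sq_le a b (j : 'I_3) q :
  symbol_re a b j q ^+ 2 + symbol_im a b j q ^+ 2 <=
  (Normc.normc (charge_fourier rho q) * (enorm q)^-1) ^+ 2 *
  \sum_(k < 3) (a k q ^+ 2 + b k q ^+ 2).
Proof.
rewrite (_ : _ + _ = (A q ^+ 2 + B q ^+ 2) *
  (cross (coulomb ^~ q) (a ^~ q) j ^+ 2 + cross (coulomb ^~ q) (b ^~ q) j ^+ 2)); last first.
  by rewrite /symbol_re /symbol_im; ring.
rewrite exprMn (_ : Normc.normc _ ^+ 2 = A q ^+ 2 + B q ^+ 2); last first.
  by rewrite /= sqr_sqrtr// addr_ge0// sqr_ge0.
rewrite -mulrA ler_wpM2l ?addr_ge0 ?sqr_ge0//.
by rewrite big_split/= mulrDr -sum_coulomb_sq; apply: lerD; exact: cross_sq_le.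
Qed.

Lemma measurable_coord3 k : measurable_fun (setT : set (mR3 R)) (fun x : mR3 R => coord3 x k).
Proof. by apply: continuous_measurable_fun3; exact: continuous_coord3. Qed.

Lemma measurable_coulomb k : measurable_fun (setT : set (mR3 R)) (coulomb k).
Proof.
apply: measurable_funM; first exact: measurable_coord3.
rewrite (_ : (fun q => _) = fun q : mR3 R => (enorm q ^+ 2) `^ (-1)); last first.
  by apply/funext => q; rewrite powR_inv1// sqr_ge0.
apply: (measurableT_comp (measurable_powR (-1))).
rewrite (_ : (fun q => _) = fun q : mR3 R => dot q q); last first.
  by apply/funext => q; rewrite enorm_sqr.
exact: measurable_dot.
Qed.

Lemma measurable_cross (x y : 'I_3 -> R3 R -> R) j :
  (forall k, measurable_fun (setT : set (mR3 R)) (x k)) ->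
  (forall k, measurable_fun (setT : set (mR3 R)) (y k)) ->
  measurable_fun (setT : set (mR3 R)) (fun q => cross (x ^~ q) (y ^~ q) j).
Proof.
by move=> mx my; apply: measurable_funB; exact: measurable_funM.
Qed.

Lemma measurable_symbol a b j :
  (forall k, measurable_fun (setT : set (mR3 R)) (a k)) ->
  (forall k, measurable_fun (setT : set (mR3 R)) (b k)) ->
  measurable_fun (setT : set (mR3 R)) (symbol_re a b j) /\
  measurable_fun (setT : set (mR3 R)) (symbol_im a b j).
Proof.
move=> ma mb; have mA := measurable_charge_cos rho; have mB := measurable_charge_sin rho.
have mca := measurable_cross j measurable_coulomb ma.
have mcb := measurable_cross j measurable_coulomb mb.
split.
- apply: (@measurableT_comp _ _ _ _ _ _ (fun t : R => - t)).
    by apply: continuous_measurable_fun => t; exact: opp_continuous.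
  by apply: measurable_funD; exact: measurable_funM.
- by apply: measurable_funB; exact: measurable_funM.
Qed.

Lemma coulombN k q : coulomb k (- q) = - coulomb k q.
Proof.
rewrite /coulomb !enorm_sqr (_ : dot (- q) (- q) = dot q q); last by rewrite !dotE/=; ring.
by rewrite -[coord3 (- q) k]/(coord_fun k (- q)) raddfN/= mulNr.
Qed.

(** The multiplier preserves the Fourier transforms of real functions. *)
Lemma symbol_parity a b j : (forall k q, a k (- q) = a k q) ->
  (forall k q, b k (- q) = - b k q) -> forall q,
  symbol_re a b j (- q) = symbol_re a b j q /\
  symbol_im a b j (- q) = - symbol_im a b j q.
Proof.
move=> ea ob q; rewrite /symbol_re /symbol_im /cross charge_cosN charge_sinN.
by rewrite !coulombN !ea !ob; split; ring.
Qed.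

End biot_savart_multiplier.

(** * Existence and energy of the velocity *)

Section velocity_of_filament.
Context {R : realType}.
Local Notation C := R[i].
Local Notation mu := (@leb3 R).
Implicit Types (q : R3 R) (v g u : @field3 R).
Variable rho : {charge set (mR3 R) -> \bar R}.

Lemma energyE v : (forall j, measurable_fun (setT : set (mR3 R)) (v j)) ->
  energy v = (\sum_(j < 3) sq_norm mu (v j))%E.
Proof.
move=> mv; rewrite /energy -leb3E -ge0_integral_sum//.
- by apply: eq_integral => x _; rewrite sumEFin.
- by move=> j; exact: measurable_sqr.
- by move=> j x _; exact: sqr_EFin_ge0.
Qed.

Lemma sq_norm_le_energy v j : (forall j, measurable_fun (setT : set (mR3 R)) (v j)) ->
  (sq_norm mu (v j) <= energy v)%E.
Proof.
move=> mv; rewrite energyE// (bigD1 j)//= leeDl// sume_ge0// => k _.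
exact: sq_norm_ge0.
Qed.

Lemma regular_distE (w f : R3 R -> R) :
  regular_dist w f = \int[mu]_x (w x * f x).
Proof. by rewrite leb3E. Qed.

Lemma capply_regular_dist (w f : R3 R -> R) :
  capply (regular_dist w) (fourier f) =
  (\int[mu]_q (w q * complex.Re (fourier f q)) +i*
   \int[mu]_q (w q * complex.Im (fourier f q)))%C.
Proof. by rewrite /capply !regular_distE. Qed.

Lemma cintegral_pair (a b f : R3 R -> R) :
  cintegral lebesgue3 (fun q => (a q +i* b q)%C * ((f q)%:C)%C) =
  (\int[mu]_q (a q * f q) +i* \int[mu]_q (b q * f q))%C.
Proof.
rewrite /cintegral -leb3E; congr (_ +i* _)%C; apply: eq_Rintegral => q _ /=; ring.
Qed.

Lemma cintegrable_pair (a b f : R3 R -> R) :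
  mu.-integrable setT (EFin \o (fun q => a q * f q)) ->
  mu.-integrable setT (EFin \o (fun q => b q * f q)) ->
  cintegrable lebesgue3 (fun q => (a q +i* b q)%C * ((f q)%:C)%C).
Proof.
move=> ia ib; rewrite /cintegrable -leb3E; split.
- by apply: eq_integrable ia => // q _ /=; congr EFin; ring.
- by apply: eq_integrable ib => // q _ /=; congr EFin; ring.
Qed.

Lemma japaneseK (s : R) q : japanese (- s) q * japanese s q = 1.
Proof.
rewrite !japaneseE -powRD; last by apply/implyP => _; rewrite gt_eqF// weight_gt0.
by rewrite mulNr addNr powRr0.
Qed.

Lemma schwartz_sq_norm_lty (f : R3 R -> R) : schwartz f -> (sq_norm mu f < +oo)%E.
Proof.
move=> /schwartz_admissible[_ mf jf [M fM]]; apply: integrable_lty => //.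
have := integrable_bounded mf fM jf; exact: eq_integrable.
Qed.

Lemma measurable_japanese (s : R) : measurable_fun (setT : set (mR3 R)) (japanese s).
Proof.
apply: continuous_measurable_fun3 => q.
by apply: differentiable_continuous; exact: differentiable_japanese.
Qed.

Lemma japaneseN (s : R) q : japanese s (- q) = japanese s q.
Proof. by rewrite !japaneseE /weight (_ : dot (- q) (- q) = dot q q)// !dotE/=; ring. Qed.

(** If the square-integrable g represents (1 - Delta)^(-alpha/2) U, then U has a
    velocity of energy at most 12 M^2 times that of g. *)
Theorem velocity_exists (alpha M : R) (U : @dfield3 R) g :
  {ae mu, forall q, Normc.normc (charge_fourier rho q) * (enorm q)^-1 *
    (1 + enorm q ^+ 2) `^ (alpha / 2) <= M} ->
  bessel_is (- alpha) U g ->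
  exists2 u, velocity_is rho U u &
    (energy u <= (12 * M ^+ 2)%:E * energy g)%E.
Proof.
move=> decay [[mg gfin] gU].
have g2 j : (sq_norm mu (g j) < +oo)%E.
  by apply: le_lt_trans gfin; exact: sq_norm_le_energy.
have [w wP] := choice (fun j => fourier_of_square_integrable (mg j) (g2 j)).
pose a (k : 'I_3) q := japanese alpha q * even_part (w k) q.
pose b (k : 'I_3) q := japanese alpha q * odd_part (w k) q.
have mw k : measurable_fun (setT : set (mR3 R)) (w k) by have [] := wP k.
have w2 k : (sq_norm mu (w k) <= hartley_cst%:E * sq_norm mu (g k))%E by have [] := wP k.
have me k : measurable_fun (setT : set (mR3 R)) (even_part (w k)) by exact: measurable_halves.
have mo k : measurable_fun (setT : set (mR3 R)) (odd_part (w k)) by exact: measurable_halves.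
have c0 := @hartley_cst_gt0 R.
have wfin k : (sq_norm mu (w k) < +oo)%E.
  apply: le_lt_trans (w2 k) _; apply: lte_mul_pinfty (g2 k) => //.
  by rewrite lee_fin ltW.
have e2 k : (sq_norm mu (even_part (w k)) <= sq_norm mu (w k))%E.
  exact: sq_norm_halves.
have o2 k : (sq_norm mu (odd_part (w k)) <= sq_norm mu (w k))%E.
  by apply: sq_norm_halves => //; rewrite sqrrN.
have ma k : measurable_fun (setT : set (mR3 R)) (a k).
  exact: measurable_funM (measurable_japanese alpha) (me k).
have mb k : measurable_fun (setT : set (mR3 R)) (b k).
  exact: measurable_funM (measurable_japanese alpha) (mo k).
have ea k q : a k (- q) = a k q.
  by rewrite /a japaneseN /even_part opprK addrC.
have ob k q : b k (- q) = - b k q.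
  by rewrite /b japaneseN /odd_part opprK; ring.
(* h is the Fourier transform of U: the bessel_is condition tested on
   (1 + |q|^2)^(alpha/2) f has f on the right-hand side *)
pose h (k : 'I_3) q : C := (a k q +i* b k q)%C.
have hU k : fourier_is (U k) (h k).
  move=> f sf; have sJf := schwartz_japanese alpha sf.
  have Jf2 := schwartz_sq_norm_lty sJf.
  have [_ mJf _ _] := schwartz_admissible sJf.
  have ie : mu.-integrable setT (EFin \o (fun q => a k q * f q)).
    have := integrable_sq_prod (me k) mJf (le_lt_trans (e2 k) (wfin k)) Jf2.
    by apply: eq_integrable => // q _ /=; congr EFin; rewrite /a; ring.
  have io : mu.-integrable setT (EFin \o (fun q => b k q * f q)).
    have := integrable_sq_prod (mo k) mJf (le_lt_trans (o2 k) (wfin k)) Jf2.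
    by apply: eq_integrable => // q _ /=; congr EFin; rewrite /b; ring.
  split; first exact: cintegrable_pair.
  rewrite cintegral_pair.
  have := gU k _ sJf.
  rewrite (_ : (fun q => _ * (_ * f q)) = f); last first.
    by apply/funext => q; rewrite mulrA japaneseK mul1r.
  move=> <-; rewrite capply_regular_dist.
  have [_ _ /(_ _ sJf)[-> ->]] := wP k.
  by congr (_ +i* _)%C; apply: eq_Rintegral => q _; rewrite /a /b; ring.
pose v1 := symbol_re rho a b.
pose v2 := symbol_im rho a b.
have mv1 j : measurable_fun (setT : set (mR3 R)) (v1 j) := (measurable_symbol rho j ma mb).1.
have mv2 j : measurable_fun (setT : set (mR3 R)) (v2 j) := (measurable_symbol rho j ma mb).2.
(* pointwise, |F u_j|^2 <= M^2 |F g|^2, and the integral of |F g|^2 is at most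
   2 hartley_cst times the energy of g *)
have v12 j : (sq_norm mu (v1 j) + sq_norm mu (v2 j) <=
    (2 * M ^+ 2 * hartley_cst)%:E * energy g)%E.
  rewrite -ge0_integralD//; [|exact: sqr_EFin_ge0|exact: measurable_sqr|exact: sqr_EFin_ge0|exact: measurable_sqr].
  pose p q := \sum_(k < 3) (even_part (w k) q ^+ 2 + odd_part (w k) q ^+ 2).
  have p0 q : 0 <= p q by apply: sumr_ge0 => k _; rewrite addr_ge0 ?sqr_ge0.
  have mp : measurable_fun (setT : set (mR3 R)) p.
    by apply: measurable_sum => k; apply: measurable_funD; exact: measurable_funX.
  apply: (@le_trans _ _ (\int[mu]_q ((M ^+ 2)%:E * (p q)%:E))%E).
    apply: ae_ge0_le_integral => //.
    - by move=> q _; rewrite adde_ge0// sqr_EFin_ge0.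
    - by apply: emeasurable_funD; exact: measurable_sqr.
    - by move=> q _; rewrite -EFinM lee_fin mulr_ge0// sqr_ge0.
    - by apply/measurable_EFinP; exact: measurable_funM.
    - apply: (@filterS _ _ (ae_filter_ringOfSetsType mu) _ _ _ decay) => q dq _.
      rewrite -EFinM -EFinD lee_fin; apply: le_trans (symbol_sq_le rho a b j q) _.
      rewrite (_ : \sum_(k < 3) _ = japanese alpha q ^+ 2 * p q); last first.
        by rewrite /p mulr_sumr; apply: eq_bigr => k _; rewrite /a /b; ring.
      rewrite mulrA -exprMn ler_wpM2r// lerXn2r ?nnegrE//.
        by rewrite !mulr_ge0 ?invr_ge0 ?enorm_ge0 ?japanese_ge0// sqrtr_ge0.
      by apply: le_trans dq; rewrite !mulr_ge0 ?invr_ge0 ?enorm_ge0 ?powR_ge0// sqrtr_ge0.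
  have mp' : measurable_fun (setT : set (mR3 R)) (fun q : mR3 R => (p q)%:E).
    exact/measurable_EFinP.
  have M20 : (0 <= (M ^+ 2)%:E)%E by rewrite lee_fin sqr_ge0.
  have -> : (\int[mu]_q ((M ^+ 2)%:E * (p q)%:E) = (M ^+ 2)%:E * \int[mu]_q (p q)%:E)%E.
    by apply: ge0_integralZl => // q _; rewrite lee_fin.
  have pE : (\int[mu]_q (p q)%:E <= (2 * hartley_cst)%:E * energy g)%E.
    rewrite (energyE mg) ge0_sume_distrr; last by move=> k _; exact: sq_norm_ge0.
    rewrite (_ : (\int[mu]_q _)%E = (\sum_(k < 3) \int[mu]_q
       ((even_part (w k) q ^+ 2)%:E + (odd_part (w k) q ^+ 2)%:E))%E); last first.
      rewrite -ge0_integral_sum//.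
      - by apply: eq_integral => q _; rewrite -sumEFin.
      - by move=> k; apply: emeasurable_funD; exact: measurable_sqr.
      - by move=> k q _; rewrite adde_ge0// sqr_EFin_ge0.
    apply: lee_sum => k _; rewrite ge0_integralD//; [|exact: sqr_EFin_ge0|exact: measurable_sqr|exact: sqr_EFin_ge0|exact: measurable_sqr].
    apply: (le_trans (leeD (e2 k) (o2 k))).
    by rewrite mulr_natl mulr2n EFinD ge0_muleDl ?lee_fin ?(ltW c0)//; exact: leeD.
  apply: (le_trans (lee_wpmul2l _ pE)); first by rewrite lee_fin sqr_ge0.
  by rewrite muleA -EFinM mulrCA mulrA.
have vfin j : (sq_norm mu (v1 j) + sq_norm mu (v2 j) < +oo)%E.
  apply: le_lt_trans (v12 j) _; rewrite lte_mul_pinfty// lee_fin.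
  apply: mulr_ge0; last exact: ltW.
  by apply: mulr_ge0 => //; exact: sqr_ge0.
have v1fin j : (sq_norm mu (v1 j) < +oo)%E.
  by apply: le_lt_trans (vfin j); rewrite leeDl// sq_norm_ge0.
have v2fin j : (sq_norm mu (v2 j) < +oo)%E.
  by apply: le_lt_trans (vfin j); rewrite leeDr// sq_norm_ge0.
have par j q := symbol_parity rho j ea ob q.
have [u uP] := choice (fun j => square_integrable_with_fourier (mv1 j) (mv2 j) (v1fin j)
  (v2fin j) (fun q => (par j q).1) (fun q => (par j q).2)).
have mu_ j : measurable_fun (setT : set (mR3 R)) (u j) by have [] := uP j.
have ub : (energy u <= (12 * M ^+ 2)%:E * energy g)%E.
  rewrite (energyE mu_).
  have M0 : 0 <= 4 * M ^+ 2 by rewrite mulr_ge0// sqr_ge0.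
  apply: (@le_trans _ _ (\sum_(j < 3) ((4 * M ^+ 2)%R%:E * energy g))%E).
    apply: lee_sum => j _; have [_ uj _] := uP j; apply: le_trans uj _.
    apply: (le_trans (lee_wpmul2l _ (v12 j))); first by rewrite lee_fin divr_ge0// ltW.
    rewrite muleA -EFinM (_ : 2 / hartley_cst * (2 * M ^+ 2 * hartley_cst) = 4 * M ^+ 2)//.
    by field; rewrite gt_eqF.
  rewrite !big_ord_recl big_ord0 adde0 -!ge0_muleDl ?adde_ge0 ?lee_fin//.
  rewrite -!EFinD (_ : 4 * M ^+ 2 + (4 * M ^+ 2 + 4 * M ^+ 2) = 12 * M ^+ 2)//; ring.
exists u => //; split; first split => //.
  by apply: le_lt_trans ub _; rewrite lte_mul_pinfty// lee_fin mulr_ge0// sqr_ge0.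
exists h; split => // j f sf.
have f2 := schwartz_sq_norm_lty sf.
have [_ mf _ _] := schwartz_admissible sf.
have -> : biot_savart_symbol rho h j = (fun q => (v1 j q +i* v2 j q)%C).
  by apply/funext => q; exact: biot_savart_symbolE.
split.
  apply: cintegrable_pair.
    exact: (integrable_sq_prod (mv1 j) mf (v1fin j) f2).
  exact: (integrable_sq_prod (mv2 j) mf (v2fin j) f2).
rewrite cintegral_pair capply_regular_dist.
by have [_ _ /(_ _ sf)[-> ->]] := uP j.
Qed.

End velocity_of_filament.

(** * The kinetic energy on the Sobolev space *)

Section kinetic_energy_continuity.
Context {R : realType}.
Local Notation C := R[i].
Local Notation mu := (@leb3 R).
Variable rho : {charge set (mR3 R) -> \bar R}.
Implicit Types (U V D : @dfield3 R) (u v : @field3 R).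

Lemma energyD_le (e : R) u v : 0 < e ->
  (forall j, measurable_fun (setT : set (mR3 R)) (u j)) ->
  (forall j, measurable_fun (setT : set (mR3 R)) (v j)) ->
  (energy (fun j x => u j x + v j x)%R <=
   (1 + e)%:E * energy u + (1 + e^-1)%:E * energy v)%E.
Proof.
move=> e0 mu' mv.
have e1 : 0 <= 1 + e by rewrite addr_ge0// ltW.
have e2 : 0 <= 1 + e^-1 by rewrite addr_ge0// invr_ge0 ltW.
rewrite !energyE//; last by move=> j; exact: measurable_funD.
rewrite !ge0_sume_distrr; [|by move=> j _; exact: sq_norm_ge0..].
by rewrite -big_split/=; apply: lee_sum => j _; exact: sq_normD.
Qed.

Lemma fourier_isD (U V W : @distribution3 R) (g h : R3 R -> C) :
  (forall f, schwartz f ->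
    capply W (fourier f) = capply U (fourier f) + capply V (fourier f)) ->
  fourier_is U g -> fourier_is V h -> fourier_is W (fun q => g q + h q).
Proof.
move=> WUV Ug Vh f sf; have [[ig1 ig2] Eg] := Ug f sf; have [[ih1 ih2] Eh] := Vh f sf.
have ReE q : complex.Re ((g q + h q) * ((f q)%:C)%C) =
    complex.Re (g q * ((f q)%:C)%C) + complex.Re (h q * ((f q)%:C)%C).
  by case: (g q) (h q) => [a b] [a' b']; rewrite /=; ring.
have ImE q : complex.Im ((g q + h q) * ((f q)%:C)%C) =
    complex.Im (g q * ((f q)%:C)%C) + complex.Im (h q * ((f q)%:C)%C).
  by case: (g q) (h q) => [a b] [a' b']; rewrite /=; ring.
split.
  split.
  - by have := integrableD measurableT ig1 ih1; apply: eq_integrable => // q _ /=; rewrite ReE.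
  - by have := integrableD measurableT ig2 ih2; apply: eq_integrable => // q _ /=; rewrite ImE.
rewrite WUV// Eg Eh /cintegral; apply/eqP; rewrite eq_complex /=; apply/andP; split; apply/eqP.
- by rewrite -RintegralD//; apply: eq_Rintegral => q _; rewrite ReE.
- by rewrite -RintegralD//; apply: eq_Rintegral => q _; rewrite ImE.
Qed.

Lemma biot_savart_symbolD (g h : 'I_3 -> R3 R -> C) j q :
  biot_savart_symbol rho (fun k q => g k q + h k q) j q =
  biot_savart_symbol rho g j q + biot_savart_symbol rho h j q.
Proof. by rewrite /biot_savart_symbol /cross; ring. Qed.

(** The Fourier transform of a Schwartz function is square integrable, hence
    integrable against square-integrable functions. *)
Lemma fourier_sq_norm_lty (f : R3 R -> R) : schwartz f ->
  [/\ measurable_fun (setT : set (mR3 R)) (fun q => complex.Re (fourier f q)),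
      measurable_fun (setT : set (mR3 R)) (fun q => complex.Im (fourier f q)),
      (sq_norm mu (fun q => complex.Re (fourier f q)) < +oo)%E &
      (sq_norm mu (fun q => complex.Im (fourier f q)) < +oo)%E].
Proof.
move=> sf; have af := schwartz_admissible sf; have [_ mf jf _] := af.
have f2 := schwartz_sq_norm_lty sf.
have c0 := @hartley_cst_gt0 R.
have H (a : R) : a ^+ 2 = 2^-1 ^+ 2 ->
   measurable_fun (setT : set (mR3 R)) (hartley (fun x : R3 R => 2^-1 * f x + a * f (- x))) /\
   (sq_norm mu (hartley (fun x : R3 R => 2^-1 * f x + a * f (- x))%R) < +oo)%E.
  move=> a2; have [_ m jh _] := admissible_halves a af.
  split; first exact: measurable_hartley.
  apply: le_lt_trans (sq_norm_hartley jh) _; apply: lte_mul_pinfty => //.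
    by rewrite lee_fin ltW.
  exact: le_lt_trans (sq_norm_halves a2 mf) f2.
have [mR R2] := H 2^-1 erefl.
have [mI I2] := H (- 2^-1) (sqrrN _).
have RE : (fun q => complex.Re (fourier f q)) = hartley (even_part f).
  by apply/funext => q; rewrite Re_fourier.
have IE : (fun q => complex.Im (fourier f q)) = hartley (odd_part f).
  by apply/funext => q; rewrite Im_fourier.
by split; [rewrite RE; exact: mR|rewrite IE; exact: mI|rewrite RE; exact: R2|rewrite IE; exact: I2].
Qed.

Lemma velocity_isD U D V u v : (forall j f, V j f = U j f + D j f) ->
  velocity_is rho U u -> velocity_is rho D v ->
  velocity_is rho V (fun j x => u j x + v j x).
Proof.
move=> VUD [[mu1 u1] [g [Ug ug]]] [[mv v1] [h [Dh vh]]].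
have mD j : measurable_fun (setT : set (mR3 R)) (fun x => u j x + v j x).
  exact: measurable_funD.
split.
  split=> //; apply: le_lt_trans (energyD_le ltr01 mu1 mv) _.
  by rewrite lte_add_pinfty// lte_mul_pinfty// lee_fin ?invr1.
exists (fun k q => g k q + h k q); split=> j.
- apply: fourier_isD (Ug j) (Dh j) => f sf.
  by rewrite /capply !VUD; apply/eqP; rewrite eq_complex /= !eqxx.
- rewrite (_ : biot_savart_symbol rho _ j = fun q =>
    biot_savart_symbol rho g j q + biot_savart_symbol rho h j q); last first.
    by apply/funext => q; exact: biot_savart_symbolD.
  apply: fourier_isD (ug j) (vh j) => f sf.
  have [mR mI R2 I2] := fourier_sq_norm_lty sf.
  have su : (sq_norm mu (u j) < +oo)%E := le_lt_trans (sq_norm_le_energy j mu1) u1.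
  have sv : (sq_norm mu (v j) < +oo)%E := le_lt_trans (sq_norm_le_energy j mv) v1.
  rewrite !capply_regular_dist; apply/eqP; rewrite eq_complex /=.
  apply/andP; split; apply/eqP; (rewrite -RintegralD//; last 2 first).
  + exact: (integrable_sq_prod (mu1 j) mR su R2).
  + exact: (integrable_sq_prod (mv j) mR sv R2).
  + by apply: eq_Rintegral => q _; rewrite mulrDl.
  + exact: (integrable_sq_prod (mu1 j) mI su I2).
  + exact: (integrable_sq_prod (mv j) mI sv I2).
  + by apply: eq_Rintegral => q _; rewrite mulrDl.
Qed.

Variables (alpha M : R).
Hypothesis decay : {ae mu, forall q, Normc.normc (charge_fourier rho q) * (enorm q)^-1 *
    (1 + enorm q ^+ 2) `^ (alpha / 2) <= M}.

(* The term 1 makes K invertible when M = 0. *)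
Let K : R := 12 * M ^+ 2 + 1.

Let K_gt0 : 0 < K.
Proof. by rewrite ltr_pwDr// mulr_ge0// sqr_ge0. Qed.

Lemma energy_ge0 v : (0 <= energy v)%E.
Proof.
by apply: integral_ge0 => x _; rewrite lee_fin sumr_ge0// => j _; rewrite sqr_ge0.
Qed.

Let velocity_existsK U g : bessel_is (- alpha) U g ->
  exists2 u, velocity_is rho U u & (energy u <= K%:E * energy g)%E.
Proof.
move=> Ug; have [u Uu uE] := velocity_exists decay Ug; exists u => //.
apply: le_trans uE _; apply: lee_wpmul2r; first exact: energy_ge0.
by rewrite lee_fin lerDl.
Qed.

(** The estimate holds for every representative g, hence for the infimum of
    their energies. *)
Lemma kinetic_energy_le U : (K^-1%:E * kinetic_energy rho U <= sobolev_norm2 (- alpha) U)%E.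
Proof.
apply: le_ereal_inf_tmp => _ [g Ug <-].
have [u Uu uE] := velocity_existsK Ug.
have -> : energy g = (K^-1%:E * (K%:E * energy g))%E.
  by rewrite muleA -EFinM mulVf ?mul1e// gt_eqF.
apply: lee_wpmul2l; first by rewrite lee_fin invr_ge0 ltW.
by apply: le_trans uE; apply: ereal_inf_lbound; exists u.
Qed.

(** If u is a velocity for U and v one for V - U, then u + v is a velocity for V,
    and its energy is at most (1 + e) |u|^2 + (1 + 1/e) |v|^2. *)
Lemma kinetic_energy_sublevel_open (c : \bar R) :
  sobolev_open (- alpha) [set U | (kinetic_energy rho U < c)%E].
Proof.
move=> U _ /= /ereal_inf_lt[_ [u Uu <-] uc].
have [_ u1] := Uu.1.
pose e0 := fine (energy u).
have uE : energy u = e0%:E by rewrite fineK// ge0_fin_numE// energy_ge0.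
have e00 : 0 <= e0 by apply: fine_ge0; exact: energy_ge0.
have [d d0 dc] : exists2 d : R, 0 < d & ((e0 + d)%:E <= c)%E.
  move: uc; rewrite uE; case: c => [c|_|//].
    rewrite lte_fin => uc; exists (c - e0); first by rewrite subr_gt0.
    by rewrite lee_fin addrC subrK.
  by exists 1 => //; rewrite leey.
(* With a margin d below c, e and r are chosen so that the two excess terms
   e |u|^2 and (1 + 1/e) K r are each at most d / 2. *)
pose e := d / (2 * (e0 + 1)).
have e1 : 0 < e0 + 1 by rewrite ltr_wpDl.
have egt0 : 0 < e by rewrite divr_gt0// mulr_gt0.
have i0 : 0 < 1 + e^-1 by rewrite ltr_pwDl// invr_ge0 ltW.
pose r := d / 2 / ((1 + e^-1) * K).
have r0 : 0 < r by rewrite !divr_gt0// mulr_gt0.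
exists r => // V _ /ereal_inf_lt[_ [g Vg <-] gr].
have [v Vv vE] := velocity_existsK Vg.
have [mu1 _] := Uu.1; have [mv _] := Vv.1.
have VUD j f : V j f = U j f + (V j f - U j f) by rewrite addrC subrK.
apply: (@le_lt_trans _ _ (energy (fun j x => u j x + v j x))).
  by apply: ereal_inf_lbound; exists (fun j x => u j x + v j x) => //; exact: velocity_isD VUD Uu Vv.
apply: le_lt_trans (energyD_le egt0 mu1 mv) _.
apply: lt_le_trans dc; rewrite uE.
have vr : (energy v < (K * r)%:E)%E.
  by apply: le_lt_trans vE _; rewrite EFinM lte_pmul2l// lte_fin.
apply: (@lt_le_trans _ _ (((1 + e) * e0)%:E + ((1 + e^-1) * (K * r))%:E)%E).
  rewrite -EFinM lteD2lE// [ltRHS]EFinM lte_pmul2l// lte_fin//.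
rewrite -EFinD lee_fin.
have -> : (1 + e^-1) * (K * r) = d / 2.
  by rewrite mulrA mulrC /r divfK// gt_eqF// mulr_gt0.
have : e * e0 <= d / 2.
  rewrite /e (_ : d / (2 * (e0 + 1)) * e0 = d / 2 * (e0 / (e0 + 1))); last by field; rewrite gt_eqF.
  by rewrite ler_piMr ?divr_ge0 ?(ltW d0)// ler_pdivrMr// mul1r lerDl.
lra.
Qed.

End kinetic_energy_continuity.

(** * Integrability of the kinetic energy *)

(** Monotonicity of the integral of nonnegative functions without measurability:
    the Sobolev norm is not known to be measurable here. *)
Lemma ge0_le_integralT d (T : measurableType d) (R : realType)
    (m : {measure set T -> \bar R}) (f g : T -> \bar R) :
  (forall x, 0 <= f x)%E -> (forall x, f x <= g x)%E ->
  (\int[m]_x f x <= \int[m]_x g x)%E.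
Proof.
move=> f0 fg; rewrite !ge0_integralTE//; last by move=> x; exact: le_trans (f0 x) (fg x).
apply: le_ereal_sup => _ [h hf <-]; exists h => // x; exact: le_trans (hf x) (fg x).
Qed.

Lemma ess_sup_bound d (T : measurableType d) (R : realType)
    (m : {measure set T -> \bar R}) (f : T -> R) :
  (ess_sup m (fun x => (f x)%:E) < +oo)%E ->
  exists M : R, {ae m, forall x, f x <= M}.
Proof.
move=> fy; exists (fine (ess_sup m (fun x => (f x)%:E))).
have := ess_sup_ge m (fun x => (f x)%:E).
apply: filterS => x.
by move: fy; case: (ess_sup _ _) => [r| |]//=.
Qed.

Theorem corollary39 (R : realType) (d : measure_display)
    (Omega : measurableType d) (P : probability Omega R)
    (H T : R) (H_gt : 1 / 4 < H) (H_lt : H < 1) (T_gt0 : 0 < T)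
    (X : 'I_3 -> R -> {RV P >-> R}) (fbmX : is_fbm3 H X)
    (xi0 : Omega -> dfield3) (core : is_vortex_core H X T xi0)
    (rho : {charge set (mR3 R) -> \bar R})
    (rho_supp : charge_compactly_supported rho)
    (rho_decay : exists2 alpha : R, alphaH H < alpha &
      (ess_sup lebesgue3 (fun q : R3 R =>
         (Normc.normc (charge_fourier rho q) * (enorm q)^-1
            * (1 + enorm q ^+ 2) `^ (alpha / 2))%:E) < +oo)%E) :
  {ae P, forall w, (kinetic_energy rho (xi0 w) < +oo)%E} /\
  P.-integrable setT (fun w => kinetic_energy rho (xi0 w)).
Proof.
have [alpha alpha_gt fin] := rho_decay.
have [M decay] := ess_sup_bound fin.
have [[sob mxi] xi_L1] := core.1 alpha alpha_gt.
have KE_ge0 w : (0 <= kinetic_energy rho (xi0 w))%E.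
  by apply: le_ereal_inf_tmp => _ [u _ <-]; exact: energy_ge0.
(* The energy is finite for every outcome, since the core always takes its values
   in the Sobolev space. *)
have KE_fin w : (kinetic_energy rho (xi0 w) < +oo)%E.
  have [_ [g xig]] := sob w.
  have [u xiu _] := velocity_exists decay xig.
  apply: le_lt_trans (proj2 xiu.1).
  by apply: ereal_inf_lbound; exists u.
split; first exact: aeW.
(* The sublevel sets are open, and they generate the Borel sets of the extended
   reals. *)
have mKE : measurable_fun setT (fun w => kinetic_energy rho (xi0 w)).
  move=> mD; apply: (measurability _ (ErealGenInftyO.measurableE R)) => //.
  move=> _ [_ [c ->] <-]; rewrite setTI.
  rewrite (_ : _ @^-1` _ = xi0 @^-1` [set U | (kinetic_energy rho U < c%:E)%E]).
    by apply: mxi; exact: kinetic_energy_sublevel_open decay _.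
  by apply/seteqP; split => w /=; rewrite in_itv.
apply/integrableP; split => //.
pose K := 12 * M ^+ 2 + 1.
have K0 : 0 < K by rewrite ltr_pwDr// mulr_ge0// sqr_ge0.
rewrite (eq_integral (fun w => K%:E * (K^-1%:E * kinetic_energy rho (xi0 w)))%E); last first.
  by move=> w _; rewrite gee0_abs// muleA -EFinM mulfV ?mul1e// gt_eqF.
have mKK : measurable_fun setT (fun w => K^-1%:E * kinetic_energy rho (xi0 w))%E.
  exact: measurable_funeM.
rewrite ge0_integralZl//; last 2 first.
- by move=> w _; rewrite mule_ge0// lee_fin invr_ge0 ltW.
- by rewrite lee_fin ltW.
apply: lte_mul_pinfty => //; first by rewrite lee_fin ltW.
apply: le_lt_trans xi_L1; apply: ge0_le_integralT => w.
  by rewrite mule_ge0// lee_fin invr_ge0 ltW.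
exact: kinetic_energy_le decay _.
Qed.
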